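(* Let $\ell\ge1$ be an integer. Let $\alpha=(\alpha_i)_{i\ge1}$ and $\beta=(\beta_i)_{i\ge1}$ be basic sequences, let $s=(s_i)_{i\ge1}$, $t=(t_i)_{i\ge1}$, $\upsilon=(\upsilon_i)_{i\ge1}$ be sequences of non-negative integers, and let $Q=Q(\alpha,\beta,s,t,\upsilon)$ be the basic sequence $$\left[[\alpha_1]^{s_1}[\beta_1]^{t_1}\right]^{\upsilon_1}\left[[\alpha_2]^{s_2}[\beta_2]^{t_2}\right]^{\upsilon_2}\left[[\alpha_3]^{s_3}[\beta_3]^{t_3}\right]^{\upsilon_3}\cdots .$$ Suppose that $Q$ is infinite in limit and fully divergent, and that the following conditions hold: $$\lim_{n\to\infty}\frac{s_n\log\alpha_n}{\sum_{i=1}^{n-1}\upsilon_it_i\log\beta_i}=0,\qquad \lim_{n\to\infty}\frac{s_n\log\alpha_n}{t_n\log\beta_n}=0,$$ $$\lim_{n\to\infty}\frac{t_n\alpha_n^{k}}{s_n\beta_n^{k}}=0\quad\text{for every integer } k\ge\ell,$$ $$\lim_{n\to\infty}\frac{t_n\alpha_n^{k}}{s_n\beta_n^{k}}>0\quad\text{for every integer } 1\le k<\ell,$$ $$\lim_{n\to\infty}\frac{\alpha_n^{k}}{s_n}=0\quad\text{for every integer } k\ge1.$$ Then $$\dim_{\mathrm H}\left(\bigcap_{j=\ell}^\infty\mathscr{N}_j(Q)\,\Big\backslash\,\bigcup_{j=1}^{\ell-1}\mathscr{N}_j(Q)\right)=1.$$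
   Context: A basic sequence is a sequence $Q=(q_n)_{n=1}^\infty$ of integers with $q_n\ge 2$ for all $n$. It is infinite in limit if $q_n\to\infty$. The $Q$-Cantor series expansion of a real number $x$ is the unique expansion $x=E_0+\sum_{n=1}^\infty \frac{E_n}{q_1q_2\cdots q_n}$ with $E_0=\lfloor x\rfloor$, $E_n\in\{0,1,\ldots,q_n-1\}$ for $n\ge1$, and $E_n\ne q_n-1$ for infinitely many $n$. Notation for sequences: $[w]^m$ denotes the finite word $w$ repeated $m$ times and juxtaposition denotes concatenation; thus $Q(\alpha,\beta,s,t,\upsilon)$ consists, for $i=1,2,3,\ldots$ in order, of $\upsilon_i$ consecutive copies of the word formed by $s_i$ terms equal to $\alpha_i$ followed by $t_i$ terms equal to $\beta_i$. The limit conditions in the claim are understood to include that the denominators appearing are nonzero for all large $n$; a condition ''$\lim>0$'' means that the limit exists in $(0,\infty]$. Put $Q_n^{(k)}=\sum_{j=1}^n \frac{1}{q_jq_{j+1}\cdots q_{j+k-1}}$. $Q$ is $k$-divergent if $\lim_{n\to\infty}Q_n^{(k)}=\infty$, and fully divergent if it is $k$-divergent for all $k\ge1$. A block of length $k$ is an ordered $k$-tuple of non-negative integers. For a block $B$ of length $k$, $N_n^Q(B,x)$ denotes the number of indices $j$ with $1\le j\le n$ such that $(E_j,E_{j+1},\ldots,E_{j+k-1})=B$. For $k\ge1$, $\mathscr{N}_k(Q)$ is the set of real $x$ such that $\lim_{n\to\infty} N_n^Q(B,x)/Q_n^{(k)}=1$ for all blocks $B$ of length $k$. $\dim_{\mathrm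 H}$ denotes Hausdorff dimension of subsets of $\mathbb{R}$. *)

(* Defs.v *)
From mathcomp Require Export all_boot all_order all_algebra.
From mathcomp Require Export all_classical all_reals all_analysis.

Set Implicit Arguments.
Unset Strict Implicit.
Unset Printing Implicit Defensive.

Import Order.TTheory GRing.Theory Num.Theory.
Import numFieldNormedType.Exports.

Local Open Scope classical_set_scope.
Local Open Scope ring_scope.

(* Sequences (u_n)_{n >= 1} are functions on nat whose value at index 0 is
   irrelevant. *)

Definition basic_sequence (q : nat -> nat) : Prop :=
  forall n, (1 <= n)%N -> (2 <= q n)%N.

Definition infinite_in_limit (q : nat -> nat) : Prop := q @ \oo --> \oo.

Section ConcatenatedSequence.
Variables alpha beta s t upsilon : nat -> nat.

Definition Qblock (i : nat) : seq nat :=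
  flatten (nseq (upsilon i) (nseq (s i) (alpha i) ++ nseq (t i) (beta i))).

Definition Qprefix (m : nat) : seq nat :=
  flatten [seq Qblock i | i <- iota 1 m].

(* q = Q(alpha, beta, s, t, upsilon). As the words Qprefix m are prefixes of one
   another, it is enough that each term of q is read off some Qprefix m; this
   also says that the concatenation of all the blocks is infinite. *)
Definition isQ (q : nat -> nat) : Prop :=
  forall n, (1 <= n)%N -> exists m,
    (n <= size (Qprefix m))%N /\ q n = nth 0%N (Qprefix m) n.-1.

End ConcatenatedSequence.

Section CantorSeries.
Variables (R : realType) (q : nat -> nat).

Definition is_cantor_expansion (x : R) (E : nat -> int) : Prop :=
  [/\ E 0%N = Num.floor x,
      forall n, (1 <= n)%N -> 0 <= E n < (q n)%:Z,
      forall m, exists2 n, (m <= n)%N & E n != (q n)%:Z - 1 &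
      ((E 0%N)%:~R + \sum_(1 <= n < m.+1)
         (E n)%:~R / \prod_(1 <= i < n.+1) (q i)%:R) @[m --> \oo] --> x].

(* When q is a basic sequence the expansion exists and is unique, so that the
   default value 0 is not used. *)
Definition cantor_digit (x : R) : nat -> int :=
  xget (fun=> 0) [set E | is_cantor_expansion x E].

Definition block_count (B : seq nat) (x : R) (n : nat) : nat :=
  count (fun j => [seq cantor_digit x i | i <- iota j (size B)]
                  == [seq b%:Z | b <- B])
        (iota 1 n).

Definition Qsum (k n : nat) : R :=
  \sum_(1 <= j < n.+1) (\prod_(j <= i < j + k) (q i)%:R)^-1.

Definition k_divergent (k : nat) : Prop := Qsum k n @[n --> \oo] --> +oo.

Definition fully_divergent : Prop := forall k, (1 <= k)%N -> k_divergent k.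

Definition normal_set (k : nat) : set R :=
  [set x | forall B : k.-tuple nat,
     ((block_count B x n)%:R / Qsum k n) @[n --> \oo] --> (1 : R)].

End CantorSeries.

Definition ratio_lim (R : realType) (a b : nat -> R) (l : \bar R) : Prop :=
  (\forall n \near \oo, b n != 0) /\ (a n / b n)%:E @[n --> \oo] --> l.

Section HausdorffDimension.
Variable R : realType.
Local Open Scope ereal_scope.

Definition ediam (U : set R) : \bar R :=
  ereal_sup [set `|x - y|%:E | x in U & y in U].

(* The empty set has weight 0 for every d, including d = 0, and 0 `^ 0 = 1:
   the 0-dimensional measure is the counting measure. *)
Definition diam_pow (d : R) (U : set R) : \bar R :=
  if `[< U = set0 >] then 0 else ediam U `^ d.

Definition hausdorff_content (d delta : R) (A : set R) : \bar R :=
  ereal_inf [set \sum_(i <oo) diam_pow d (U i) | U in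
    [set U : nat -> set R |
       A `<=` \bigcup_i U i /\ forall i, ediam (U i) <= delta%:E]].

Definition hausdorff_measure (d : R) (A : set R) : \bar R :=
  ereal_sup [set hausdorff_content d delta A | delta in [set e | (0 < e)%R]].

Definition hausdorff_dim (A : set R) : \bar R :=
  ereal_inf [set d%:E | d in [set d | (0 <= d)%R /\ hausdorff_measure d A = 0]].

End HausdorffDimension.

(* Main.v *)
Require Import Defs.
From mathcomp Require Import ring lra zify.
Import Order.TTheory GRing.Theory Num.Theory.
Import numFieldNormedType.Exports.
Local Open Scope classical_set_scope.
Local Open Scope ring_scope.
Set Implicit Arguments.
Unset Strict Implicit.
Unset Printing Implicit Defensive.

(** Call an occurrence of [[alpha_i]^(s_i) [beta_i]^(t_i)] a pass. In the run of
    [alpha_i] all digits are prescribed: every word of length [k >= l] is written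
    there with density [alpha_i^-k], the other digits being the large filler
    [alpha_i - 1]. In the run of [beta_i] the digits are free in an interval of
    about [beta_i / 2] large values, so that no fixed word meets it. For
    [k >= l] the runs of [beta_i] contribute a negligible part of [Q_n^(k)], and
    the resulting points are normal of order [k]. A word of length [k < l] only
    appears inside the prescribed longer words, hence with density
    [o(alpha_i^-k)], and normality of order [k] fails.

    The prescribed runs carry a negligible part of [log (q_1 ... q_n)], so for
    every [d < 1] the greedy expansion in the bases given by the numbers of
    admissible digits maps [[0, 1)] into the set by a map whose inverse is
    Hölder of exponent [d]. Countable subadditivity of Lebesgue measure then
    bounds the [d]-dimensional measure of the set from below. *)

(** * Hausdorff dimension of subsets of the line *)

(** All words are prescribed at once: each stretch of [a] places has one slot per word, at dyadic
    positions, and the slots occupy only O(log^2 a) places. A word of length k is written in one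
    stretch out of a^(k-1). An accidental occurrence comes from a strictly longer word, hence from
    one stretch out of a^k and from one of the slots, so accidents have density o(a^-k). This single
    estimate gives normality from [l] on and its failure below. The free digits use only half of the
    base so that the tail of an expansion cannot cancel the first difference of two digits. This
    costs a bounded factor per digit, negligible against [b], which tends to infinity. The limits
    are over all n, also inside a pass, and a block may be repeated many times. Every estimate is
    therefore made for a partial pass up to an error independent of the pass, and full passes must
    repay it: a full run has mass s/a^k, which tends to infinity. Word counts and Q_n^(k) are not
    compared with each other but with a common quantity, the mass of the prescribed runs alone. *)

Lemma nneseries_le_bound (R : realType) (f : nat -> \bar R) (M : \bar R) :
  (forall n, (0 <= f n)%E) ->
  (forall n, (\sum_(0 <= i < n) f i <= M)%E) ->
  (\sum_(i <oo) f i <= M)%E.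
Proof.
move=> f0 fM; apply: lime_le; first by apply: is_cvg_nneseries => n _ _.
exact: nearW.
Qed.

Lemma ediam_le (R : realType) (U : set R) (e : R) :
  (forall x y, U x -> U y -> `|x - y| <= e) -> (ediam U <= e%:E)%E.
Proof.
by move=> He; apply: ge_ereal_sup => _ [x Ux [y Uy <-]]; rewrite lee_fin He.
Qed.

Lemma le_ediam (R : realType) (U : set R) (x y : R) :
  U x -> U y -> (`|x - y|%:E <= ediam U)%E.
Proof. by move=> Ux Uy; apply: ereal_sup_ubound; exists x => //; exists y. Qed.

Lemma diam_pow_ge0 (R : realType) (d : R) (U : set R) : (0 <= diam_pow d U)%E.
Proof. by rewrite /diam_pow; case: ifP => // _; exact: poweR_ge0. Qed.

Lemma diam_pow_le (R : realType) (d e : R) (U : set R) :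
  0 <= d -> 0 <= e -> (forall x y, U x -> U y -> `|x - y| <= e) ->
  (diam_pow d U <= (e `^ d)%:E)%E.
Proof.
move=> d0 e0 He; rewrite /diam_pow; case: ifPn => [_|/asboolPn/eqP/set0P[x Ux]].
  by rewrite lee_fin powR_ge0.
rewrite -poweR_EFin; apply: gt0_ler_poweR => //.
- rewrite in_itv/= leey andbT.
  by have := le_ediam Ux Ux; rewrite subrr normr0.
- by rewrite in_itv/= leey andbT lee_fin.
- exact: ediam_le.
Qed.

Lemma hausdorff_content_ge0 (R : realType) (d e : R) (A : set R) :
  (0 <= hausdorff_content d e A)%E.
Proof.
apply: le_ereal_inf_tmp => _ [U _ <-].
by apply: nneseries_ge0 => n _ _; exact: diam_pow_ge0.
Qed.

Section RealLineCover.
Variable R : realType.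

Definition cover_size (n : nat) : R := (2 ^- trunc_log 2 n)%R.

Definition int_enum (k : nat) : int := odflt 0 (unpickle k).

(* The dyadic block [2^k <= n < 2^k.+1] of indices covers one unit interval by
   [2^k] intervals of length [2^-k], so that the total [d]-weight is a geometric
   series of ratio [2^(1-d)]. *)
Definition cover_set (e : R) (n : nat) : set R :=
  let k := trunc_log 2 n in
  let c := (int_enum k)%:~R + (n - 2 ^ k)%:R * cover_size n in
  [set x | e * c <= x <= e * (c + cover_size n)].

Lemma cover_sizeP (k j : nat) : (j < 2 ^ k)%N -> cover_size (2 ^ k + j) = 2 ^- k.
Proof.
by move=> jk; rewrite /cover_size (@trunc_log_eq 2 k)// leq_addr/= expnS mul2n -addnn ltn_add2l.
Qed.

Lemma cover_set_cover (e : R) : 0 < e -> setT `<=` \bigcup_n cover_set e n.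
Proof.
move=> e0 x _; pose y := x / e; pose z := Num.floor y; pose k := pickle z.
have xE : x = e * y by rewrite /y mulrC divfK// gt_eqF.
have /andP[zy yz] : (z%:~R <= y < z%:~R + 1).
  by have := floor_itv y; rewrite -/z intrD.
have k0 : 0 < 2 ^+ k :> R by rewrite exprn_gt0.
pose w := 2 ^+ k * (y - z%:~R).
have w0 : 0 <= w by rewrite mulr_ge0 ?(ltW k0)// subr_ge0.
have w1 : w < 2 ^+ k by rewrite -[ltRHS]mulr1 ltr_pM2l// ltrBlDl.
have /andP[jw wj] := truncn_itv w0; set j := Num.truncn w in jw wj.
have jk : (j < 2 ^ k)%N by rewrite -(ltr_nat R) natrX (le_lt_trans jw).
exists (2 ^ k + j)%N => //; rewrite /cover_set/= cover_sizeP//.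
have -> : trunc_log 2 (2 ^ k + j) = k.
  by apply: trunc_log_eq => //; rewrite leq_addr/= expnS mul2n -addnn ltn_add2l.
have -> : int_enum k = z by rewrite /int_enum pickleK.
rewrite addKn xE !ler_pM2l//.
have yE : y = z%:~R + w * 2 ^- k by rewrite /w mulrAC divff ?gt_eqF// mul1r; lra.
have k1 : 0 < 2 ^- k :> R by rewrite invr_gt0.
rewrite {1 2}yE -addrA !lerD2l ler_pM2r// jw/=.
rewrite -[X in _ + X]mul1r -mulrDl ler_pM2r//.
by rewrite -natr1 in wj; exact: ltW.
Qed.

Lemma cover_size_sum (d : R) : 1 < d ->
  exists C : R, forall n, \sum_(0 <= i < n) cover_size i `^ d <= C.
Proof.
move=> d1; pose r : R := 2 `^ (1 - d).
have r0 : 0 <= r by exact: powR_ge0.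
have r1 : r < 1.
  by rewrite /r /powR pnatr_eq0/= expR_lt1 nmulr_rlt0 ?ln_gt0 ?ltr1n// subr_lt0.
have S2 K : \sum_(0 <= i < 2 ^ K) cover_size i `^ d
            = 1 + \sum_(0 <= k < K) r ^+ k.
  elim: K => [|K IH].
    by rewrite expn0 big_nat1 big_geq// addr0 /cover_size trunc_log0 invr1 powR1.
  rewrite (@big_cat_nat _ _ _ (2 ^ K)) ?leq_exp2l//= IH big_nat_recr//= addrA.
  congr (_ + _).
  rewrite expnS mul2n -addnn -{1}[X in \sum_(X <= _ < _) _]add0n big_addn addnK.
  rewrite (eq_big_nat _ _ (F2 := fun=> (2 ^- K) `^ d)); last first.
    by move=> i /andP[_ iK]; rewrite addnC cover_sizeP.
  rewrite sumr_const_nat subn0 -[LHS]mulr_natl natrX /r.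
  rewrite -(@powR_mulrn _ 2)// -powRN -powRrM -powR_mulrn ?powR_ge0// -powRrM -powRD; last first.
    by apply/implyP => _; rewrite pnatr_eq0.
  by congr (_ `^ _); ring.
exists (1 + (1 - r)^-1) => n.
have [K nK] : exists K, (n <= 2 ^ K)%N by exists n; exact/ltnW/ltn_expl.
apply: (@le_trans _ _ (\sum_(0 <= i < 2 ^ K) cover_size i `^ d)).
  rewrite [leRHS](@big_cat_nat _ _ _ n)//= lerDl sumr_ge0// => i _.
  exact: powR_ge0.
rewrite S2 lerD2l -[leRHS]mul1r ler_pdivlMr ?subr_gt0//.
have -> : (\sum_(0 <= k < K) r ^+ k) * (1 - r) = 1 - r ^+ K.
  elim: K {nK} => [|K IH]; first by rewrite big_geq// mul0r expr0 subrr.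
  by rewrite big_nat_recr//= mulrDl IH exprS; ring.
by rewrite gerBl exprn_ge0.
Qed.

(** Scaling the countable cover of the whole line by [e] multiplies its finite total weight by the
    [d]-th power of [e], which tends to 0 with [e]. *)
Lemma hausdorff_content_gt1 (d delta : R) (A : set R) : 1 < d -> 0 < delta ->
  hausdorff_content d delta A = 0%E.
Proof.
move=> d1 delta0; apply/eqP; rewrite eq_le hausdorff_content_ge0 andbT.
have d0 : 0 <= d by lra.
have [C HC] := cover_size_sum d1.
have C0 : 0 <= C by have := HC 0%N; rewrite big_geq.
have cs n : 0 <= cover_size n <= 1.
  rewrite /cover_size invr_ge0 exprn_ge0//= invf_le1 ?exprn_gt0//.
  by rewrite exprn_ege1// ler1n.
have key e : 0 < e -> e <= delta ->
    (hausdorff_content d delta A <= (e `^ d * C)%:E)%E.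
  move=> e0 ed; apply: ge_ereal_inf.
  exists (\sum_(i <oo) diam_pow d (cover_set e i))%E.
    exists (cover_set e) => //; split.
      by move=> x _; apply: cover_set_cover.
    move=> i; apply: ediam_le => x y /andP[x1 x2] /andP[y1 y2].
    have : e * cover_size i <= e by rewrite ler_piMr ?(ltW e0)//; case/andP: (cs i).
    rewrite mulrDr in x2 y2; rewrite ler_norml; lra.
  apply: nneseries_le_bound => [n|n]; first exact: diam_pow_ge0.
  apply: (@le_trans _ _ (\sum_(0 <= i < n) ((e * cover_size i) `^ d)%:E)%E).
    apply: lee_sum => i _; apply: diam_pow_le => //.
      by rewrite mulr_ge0 ?(ltW e0)//; case/andP: (cs i).
    move=> x y /andP[x1 x2] /andP[y1 y2]; rewrite mulrDr in x2 y2.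
    by rewrite ler_norml; lra.
  rewrite sumEFin lee_fin.
  under eq_bigr => i _ do rewrite (powRM _ (ltW e0) (proj1 (andP (cs i)))).
  by rewrite -mulr_sumr ler_wpM2l ?powR_ge0.
apply/lee_addgt0Pr => eta eta0; rewrite add0e.
(* Since [e <= 1 < d], the [d]-th power of [e] is at most [e]; the denominator [C + 1] stays
   positive when [C = 0]. *)
pose e := Num.min (Num.min delta 1) (eta / (C + 1)).
have e0 : 0 < e by rewrite !lt_min delta0 ltr01 divr_gt0// ltr_wpDl.
have e1 : e <= 1 by rewrite !ge_min lexx orbT.
apply: (le_trans (key e e0 _)); first by rewrite !ge_min lexx.
rewrite lee_fin; apply: (@le_trans _ _ (e * C)).
  rewrite ler_wpM2r// -[leRHS]powRr1 ?(ltW e0)//.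
  by apply: ger_powR; [rewrite e0|exact: ltW].
apply: (@le_trans _ _ (eta / (C + 1) * C)).
  by rewrite ler_wpM2r// !ge_min lexx orbT.
by rewrite mulrAC ler_pdivrMr ?ltr_wpDl// ler_pM2l//; lra.
Qed.

End RealLineCover.

Lemma hausdorff_dim_le1 (R : realType) (A : set R) : (hausdorff_dim A <= 1)%E.
Proof.
apply/lee_addgt0Pr => e e0; apply: ereal_inf_lbound; exists (1 + e) => //.
split; first by lra.
apply/eqP; rewrite eq_le; apply/andP; split.
  apply: ge_ereal_sup => _ [delta /= delta0 <-].
  by rewrite hausdorff_content_gt1//; lra.
apply: ereal_sup_ubound; exists 1 => /=; first exact: ltr01.
by rewrite hausdorff_content_gt1//; lra.
Qed.

(** A cover of [A] pulls back along [phi] to a cover of [0, 1) by sets lying in intervals of length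
    at most 2C times the [d]-th power of the original diameter. Subadditivity of Lebesgue measure
    then bounds the weight of the cover below by 1/(2C). The intervals are there because the pulled
    back sets may fail to be measurable. *)
Lemma hausdorff_dim_ge1 (R : realType) (A : set R) :
  (forall d : R, 0 <= d -> d < 1 -> exists (phi : R -> R) (C : R),
    (forall y : R, 0 <= y < 1 -> A (phi y)) /\
    (forall y y' : R, 0 <= y < 1 -> 0 <= y' < 1 ->
       `|y - y'| <= C * `|phi y - phi y'| `^ d)) ->
  (1 <= hausdorff_dim A)%E.
Proof.
move=> HA; apply: le_ereal_inf_tmp => _ [d [d0 Hd] <-].
rewrite lee_fin leNgt; apply/negP => d1.
have [phi [C0 [phiA phiC0]]] := HA d d0 d1.
pose C := Num.max C0 1.
have Cgt0 : 0 < C by rewrite lt_max ltr01 orbT.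
have phiC (y y' : R) : 0 <= y < 1 -> 0 <= y' < 1 ->
    `|y - y'| <= C * `|phi y - phi y'| `^ d.
  move=> y01 y'01; apply: (le_trans (phiC0 _ _ y01 y'01)).
  by rewrite ler_wpM2r ?powR_ge0// le_max lexx.
suff : ((2 * C)^-1%:E <= hausdorff_measure d A)%E.
  by rewrite Hd lee_fin leNgt invr_gt0 mulr_gt0.
(* The measure is a supremum over scales, so the scale 1 is enough; it keeps the diameters
   finite. *)
apply: (@le_trans _ _ (hausdorff_content d 1 A)); last first.
  by apply: ereal_sup_ubound; exists 1 => //=; exact: ltr01.
apply: le_ereal_inf_tmp => _ [U [AU U1] <-].
pose V i : set R := [set y | 0 <= y < 1 /\ U i (phi y)].
have HV i : exists2 I : set R, measurable I /\ V i `<=` I &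
    (lebesgue_measure I <= (2 * C)%:E * diam_pow d (U i))%E.
  have [V0|/set0P[y0 [y01 Uy0]]] := eqVneq (V i) set0.
    exists set0; first by split => //; rewrite V0.
    by rewrite measure0 mule_ge0 ?lee_fin ?mulr_ge0 ?(ltW Cgt0)// diam_pow_ge0.
  have Ui : U i != set0 by apply/set0P; exists (phi y0).
  have dge0 : (0 <= ediam (U i))%E.
    by have := le_ediam Uy0 Uy0; rewrite subrr normr0.
  have dfin : ediam (U i) \is a fin_num.
    by rewrite ge0_fin_numE// (le_lt_trans (U1 i))// ltry.
  pose D := fine (ediam (U i)).
  have DE : ediam (U i) = D%:E by rewrite fineK.
  have D0 : 0 <= D by rewrite -lee_fin -DE.
  exists (`[y0 - C * D `^ d, y0 + C * D `^ d]%classic : set R).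
    split => // y [y01' Uy]; rewrite /= in_itv/= -ler_distlC.
    rewrite distrC; apply: (le_trans (phiC _ _ _ _)) => //.
    rewrite ler_pM2l//; apply: ge0_ler_powR; rewrite ?nnegrE//.
    by rewrite -lee_fin -DE; exact: le_ediam.
  rewrite lebesgue_measure_itv/= /diam_pow asboolF; last exact/eqP.
  rewrite DE poweR_EFin -EFinM; case: ifPn => _; last first.
    by rewrite lee_fin !mulr_ge0 ?(ltW Cgt0)// powR_ge0.
  by rewrite -EFinB lee_fin; lra.
have /choice[I HI] : forall i, exists I : set R, [/\ measurable I, V i `<=` I &
    (lebesgue_measure I <= (2 * C)%:E * diam_pow d (U i))%E].
  by move=> i; have [I [? ?] ?] := HV i; exists I.
have : (lebesgue_measure (`[0%R, 1%R[%classic : set R) <= \sum_(i <oo) lebesgue_measure (I i))%E.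
  apply: (measure_sigma_subadditive lebesgue_measure) => //.
    by move=> i; case: (HI i).
  move=> y /=; rewrite in_itv/= => y01.
  have [i _ Ui] := AU _ (phiA _ y01); exists i => //.
  by case: (HI i) => _ VI _; apply: VI; split.
rewrite lebesgue_measure_itv/= lte_fin ltr01 -EFinB subr0 => le1.
have le2 : (1 <= (2 * C)%:E * \sum_(i <oo) diam_pow d (U i))%E.
  apply: (le_trans le1); rewrite -nneseriesZl//; last by move=> *; exact: diam_pow_ge0.
  apply: lee_nneseries => [i _ _|i _]; first exact: measure_ge0.
  by case: (HI i).
have C20 : 0 < 2 * C by rewrite mulr_gt0.
rewrite -[leLHS]mule1.
apply: (@le_trans _ _ ((2 * C)^-1%:E * ((2 * C)%:E * \sum_(i <oo) diam_pow d (U i)))%E).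
  by apply: lee_wpmul2l => //; rewrite lee_fin invr_ge0 ltW.
by rewrite muleA -EFinM mulVf ?gt_eqF// mul1e.
Qed.

(** * Cantor series expansions *)

Section CantorExpansion.
Variables (R : realType) (q : nat -> nat).
Hypothesis hq : basic_sequence q.

Definition qprod (n : nat) : R := \prod_(1 <= i < n.+1) (q i)%:R.

Definition cantor_sum (E : nat -> int) (n : nat) : R :=
  (E 0%N)%:~R + \sum_(1 <= k < n.+1) (E k)%:~R / qprod k.

Lemma qprod0 : qprod 0 = 1.
Proof. by rewrite /qprod big_geq. Qed.

Lemma qprodS n : qprod n.+1 = qprod n * (q n.+1)%:R.
Proof. by rewrite /qprod big_nat_recr. Qed.

Lemma q_gt0 n : 0 < (q n.+1)%:R :> R.
Proof. by rewrite ltr0n; exact: (leq_trans _ (@hq n.+1 isT)). Qed.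

Lemma qprod_gt0 n : 0 < qprod n.
Proof. by elim: n => [|n IH]; rewrite ?qprod0// qprodS mulr_gt0// q_gt0. Qed.

Lemma qprod_ge2 n : 2 ^+ n <= qprod n.
Proof.
elim: n => [|n IH]; first by rewrite qprod0 expr0.
by rewrite qprodS exprSr ler_pM// ?exprn_ge0// ler_nat; exact: hq.
Qed.

Lemma cantor_sumS E n :
  cantor_sum E n.+1 = cantor_sum E n + (E n.+1)%:~R / qprod n.+1.
Proof. by rewrite /cantor_sum big_nat_recr//= addrA. Qed.

Lemma invr_qprodS n : (qprod n)^-1 = (q n.+1)%:R / qprod n.+1.
Proof.
by rewrite qprodS invfM mulrCA divff ?mulr1// gt_eqF// q_gt0.
Qed.

Section Bounds.
Variable E : nat -> int.
Hypothesis E_itv : forall n, (1 <= n)%N -> 0 <= E n < (q n)%:Z.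

Lemma cantor_sum_nondecreasing : nondecreasing_seq (cantor_sum E).
Proof.
apply/nondecreasing_seqP => n; rewrite cantor_sumS lerDl.
by rewrite divr_ge0 ?(ltW (qprod_gt0 _))// ler0z; case/andP: (@E_itv n.+1 isT).
Qed.

(** A digit is at most [q n.+1 - 1], so the interval that it selects ends inside the previous one:
    the intervals from [cantor_sum E n] to [cantor_sum E n + (qprod n)^-1] are nested. *)
Lemma cantor_upper_nonincreasing :
  nonincreasing_seq (fun n => cantor_sum E n + (qprod n)^-1).
Proof.
apply/nonincreasing_seqP => n; rewrite cantor_sumS (invr_qprodS n) -addrA lerD2l.
rewrite -[X in _ + X]mul1r -mulrDl ler_pM2r ?invr_gt0 ?qprod_gt0//.
rewrite -[1]/(1%:~R) -intrD -[(q _)%:R]/((q n.+1)%:Z%:~R) ler_int.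
by have := @E_itv n.+1 isT; lia.
Qed.

Lemma cantor_upper_lt n : E n.+1 != (q n.+1)%:Z - 1 ->
  cantor_sum E n.+1 + (qprod n.+1)^-1 < cantor_sum E n + (qprod n)^-1.
Proof.
move=> En; rewrite cantor_sumS (invr_qprodS n) -addrA ltrD2l.
rewrite -[X in _ + X]mul1r -mulrDl ltr_pM2r ?invr_gt0 ?qprod_gt0//.
rewrite -[1]/(1%:~R) -intrD -[(q _)%:R]/((q n.+1)%:Z%:~R) ltr_int.
by have := @E_itv n.+1 isT; move/eqP : En; lia.
Qed.

Lemma cantor_sum_is_cvg : cvgn (cantor_sum E).
Proof.
apply: nondecreasing_is_cvgn; first exact: cantor_sum_nondecreasing.
exists (cantor_sum E 0 + (qprod 0)^-1) => _ [n _ <-].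
apply: le_trans (cantor_upper_nonincreasing (leq0n n)).
by rewrite lerDl invr_ge0 ltW// qprod_gt0.
Qed.

Hypothesis E_io : forall m, exists2 n, (m <= n)%N & E n != (q n)%:Z - 1.

(** Nesting gives the weak inequalities. The right one is strict because some later digit is not
    maximal, and there the upper end drops strictly. *)
Lemma cantor_lim_itv (x : R) n : cantor_sum E m @[m --> \oo] --> x ->
  cantor_sum E n <= x < cantor_sum E n + (qprod n)^-1.
Proof.
move=> Ex; have xE : limn (cantor_sum E) = x by apply: cvg_lim.
apply/andP; split.
  rewrite -xE; apply: nondecreasing_cvgn_le; first exact: cantor_sum_nondecreasing.
  exact: cantor_sum_is_cvg.
have ub m : x <= cantor_sum E m + (qprod m)^-1.
  rewrite -xE; apply: limr_le; first exact: cantor_sum_is_cvg.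
  exists m => // k /= mk; apply: le_trans (cantor_upper_nonincreasing mk).
  by rewrite lerDl invr_ge0 ltW// qprod_gt0.
have [[//|m] nm Em] := E_io n.+1.
apply: (le_lt_trans (ub m.+1)); apply: (lt_le_trans (cantor_upper_lt Em)).
exact: cantor_upper_nonincreasing.
Qed.

End Bounds.

(** A digit is thus determined by [x] and the digits before it, whence uniqueness by induction. *)
Lemma cantor_expansion_floor (x : R) E n : is_cantor_expansion q x E ->
  E n.+1 = Num.floor (qprod n.+1 * (x - cantor_sum E n)).
Proof.
move=> [E0 Ei Eio Ex]; apply/esym/floor_def.
have /andP[] := cantor_lim_itv Ei Eio n.+1 Ex.
rewrite cantor_sumS => l u; have P0 := qprod_gt0 n.+1.
rewrite intrD.
have -> : (E n.+1)%:~R = qprod n.+1 * ((E n.+1)%:~R / qprod n.+1) :> R.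
  by rewrite mulrC divfK// gt_eqF.
rewrite ler_pM2l// lerBrDl l/=.
rewrite -[1%:~R](@divff _ (qprod n.+1)) ?gt_eqF//.
by rewrite -mulrDr ltr_pM2l// ltrBlDl addrA.
Qed.

Lemma cantor_expansion_unique (x : R) E E' : is_cantor_expansion q x E ->
  is_cantor_expansion q x E' -> E = E'.
Proof.
move=> xE xE'; apply/funext.
have E0 : E 0%N = E' 0%N by case: xE => ->; case: xE' => ->.
suff H n : forall k, (k <= n)%N -> E k = E' k by move=> n; exact: (H n).
elim: n => [k|n IH k]; first by rewrite leqn0 => /eqP->.
rewrite leq_eqVlt => /predU1P[->|]; last by rewrite ltnS; exact: IH.
rewrite (cantor_expansion_floor n xE) (cantor_expansion_floor n xE').
congr (Num.floor (_ * (_ - _))); rewrite /cantor_sum E0; congr (_ + _).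
by apply: eq_big_nat => i /andP[_ ni]; rewrite IH.
Qed.

Lemma cantor_digitE (x : R) E : is_cantor_expansion q x E -> cantor_digit q x = E.
Proof.
move=> xE; apply: xget_unique => // E' xE'.
exact: cantor_expansion_unique xE' xE.
Qed.

(** The integer part is forced to 0 whatever [e 0] is, so that the point lies in [0, 1). *)
Definition digits0 (e : nat -> nat) (n : nat) : int := if n is 0 then 0 else (e n)%:Z.

Definition cantor_val (e : nat -> nat) : R := limn (cantor_sum (digits0 e)).

Section Value.
Variable e : nat -> nat.
Hypothesis e_lt : forall n, (1 <= n)%N -> (e n < q n)%N.
Hypothesis e_io : forall m, exists2 n, (m <= n)%N & (e n).+1 != q n.

Let e_itv n : (1 <= n)%N -> 0 <= digits0 e n < (q n)%:Z.
Proof. by case: n => // n _; have := @e_lt n.+1 isT; rewrite /digits0; lia. Qed.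

Lemma cantor_val_cvg : cantor_sum (digits0 e) m @[m --> \oo] --> cantor_val e.
Proof. exact: (cantor_sum_is_cvg e_itv). Qed.

Lemma cantor_valP : is_cantor_expansion q (cantor_val e) (digits0 e).
Proof.
have io m : exists2 n, (m <= n)%N & digits0 e n != (q n)%:Z - 1.
  have [[|n] mn /eqP en] := e_io m.+1; first by [].
  by exists n.+1; [exact: ltnW|apply/eqP; rewrite /digits0; lia].
split => //.
- apply/esym/floor_def; have := cantor_lim_itv e_itv io 0 cantor_val_cvg.
  by rewrite /cantor_sum big_geq// addr0 qprod0 invr1 add0r.
- exact: cantor_val_cvg.
Qed.

Lemma cantor_val_digit n : (1 <= n)%N ->
  cantor_digit q (cantor_val e) n = (e n)%:Z.
Proof. by case: n => // n _; rewrite (cantor_digitE cantor_valP). Qed.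

End Value.

(* The tail is at most half of the last separating unit because the digits of
   the two points differ by at most half of the base. *)
Lemma cantor_val_dist (e e' : nat -> nat) n :
  (forall k, (1 <= k)%N -> (e k < q k)%N) ->
  (forall k, (1 <= k)%N -> (e' k < q k)%N) ->
  (forall k, (1 <= k)%N -> (2 * `|(e k)%:Z - (e' k)%:Z|%N < q k)%N) ->
  (forall k, (1 <= k <= n)%N -> e k = e' k) ->
  e n.+1 != e' n.+1 ->
  `|(e n.+1)%:R - (e' n.+1)%:R| / (2 * qprod n.+1) <=
    `|cantor_val e - cantor_val e'|.
Proof.
move=> e_lt e'_lt ee' agree neq.
set d : R := (e n.+1)%:R - (e' n.+1)%:R.
have P0 := qprod_gt0 n.+1.
have natE k (f : nat -> nat) : (digits0 f k.+1)%:~R = (f k.+1)%:R :> R by [].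
pose S k := cantor_sum (digits0 e) k - cantor_sum (digits0 e') k.
have S_n : S n = 0.
  apply/eqP; rewrite subr_eq0; apply/eqP; rewrite /cantor_sum; congr (_ + _).
  apply: eq_big_nat => -[//|k] /andP[_ kn].
  by rewrite /digits0 agree.
have SS k : S k.+1 = S k + ((e k.+1)%:R - (e' k.+1)%:R) / qprod k.+1.
  by rewrite /S !cantor_sumS !natE mulrBl; ring.
(* Telescoping: a digit difference is at most [(q k - 1) / 2], and [(q k - 1) / qprod k] equals
   [(qprod k.-1)^-1 - (qprod k)^-1]. *)
have tail j : `|S (n.+1 + j)%N - d / qprod n.+1| <=
    2^-1 * ((qprod n.+1)^-1 - (qprod (n.+1 + j))^-1).
  elim: j => [|j IH].
    by rewrite addn0 SS S_n add0r !subrr mulr0 normr0.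
  rewrite addnS SS addrAC.
  apply: (le_trans (ler_normD _ _)); apply: (le_trans (lerD IH (lexx _))).
  set m := (n.+1 + j)%N.
  have Pm := qprod_gt0 m.+1.
  rewrite [(qprod m)^-1]invr_qprodS normrM normfV (gtr0_norm Pm).
  suff : `|(e m.+1)%:R - (e' m.+1)%:R| <= 2^-1 * ((q m.+1)%:R - 1) :> R.
    rewrite -(ler_pM2r (x := (qprod m.+1)^-1)) ?invr_gt0// mulrBr; lra.
  have -> : (e m.+1)%:R - (e' m.+1)%:R = ((e m.+1)%:Z - (e' m.+1)%:Z)%:~R :> R.
    by rewrite intrD mulrNz.
  rewrite -intr_norm -abszE.
  have := ee' m.+1 isT; set a := `|_|%N; rewrite -(ltr_nat R) => H.
  have : (2 * a).+1%:R <= (q m.+1)%:R :> R by rewrite ler_nat -(ltr_nat R).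
  by rewrite -natr1 natrM => ?; rewrite -[(_%:Z)%:~R]/(a%:R); lra.
have Slim : S k @[k --> \oo] --> cantor_val e - cantor_val e'.
  by apply: cvgB; exact: cantor_val_cvg.
have Dlim : `|S (n.+1 + j)%N - d / qprod n.+1| @[j --> \oo] -->
    `|cantor_val e - cantor_val e' - d / qprod n.+1|.
  apply: cvg_norm; apply: cvgB; last exact: cvg_cst.
  under eq_fun do rewrite addnC.
  by move: Slim; rewrite -(cvg_shiftn n.+1).
have : `|cantor_val e - cantor_val e' - d / qprod n.+1| <= 2^-1 * (qprod n.+1)^-1.
  have := Dlim => /cvg_lim <- //; apply: limr_le.
    by apply/cvg_ex; eexists; exact: Dlim.
  apply: nearW => j; apply: (le_trans (tail j)).
  by rewrite ler_pM2l// gerBl invr_ge0 ltW// qprod_gt0.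
have d1 : 1 <= `|d|.
  have -> : d = ((e n.+1)%:Z - (e' n.+1)%:Z)%:~R by rewrite intrD mulrNz.
  rewrite -intr_norm -[1]/(1%:~R) ler_int; move/eqP: neq; lia.
have dP : `|d / qprod n.+1| = `|d| / qprod n.+1 by rewrite normrM normfV (gtr0_norm P0).
have tri : `|d / qprod n.+1| <= `|cantor_val e - cantor_val e'| +
    `|cantor_val e - cantor_val e' - d / qprod n.+1|.
  rewrite -[X in `|X| <= _](subrK (cantor_val e - cantor_val e')) addrC.
  by rewrite (le_trans (ler_normD _ _))// lerD2l distrC.
rewrite invfM mulrCA => H.
have : (qprod n.+1)^-1 <= `|d| / qprod n.+1.
  by rewrite -[leLHS]mul1r ler_pM2r ?invr_gt0.
rewrite dP in tri.
lra.
Qed.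

End CantorExpansion.

(** * Points with free digits *)

Lemma digit_dist_lt (h a b g q : nat) : (a < g -> b < g -> 2 * g <= q.+1 ->
  2 * `|(h + a)%N%:Z - (h + b)%N%:Z|%N < q)%N.
Proof. lia. Qed.

Lemma digit_dist_itv (a b g : nat) : (a < g -> b < g -> a != b ->
  0 < `|a%:Z - b%:Z|%N < g)%N.
Proof. lia. Qed.

Section FreeDigits.
Variables (R : realType) (q g h : nat -> nat).
Hypothesis hq : basic_sequence q.
Hypothesis g_gt0 : forall n, (0 < g n)%N.
Hypothesis gq : forall n, (1 <= n)%N -> (2 * g n <= (q n).+1)%N.
Hypothesis hgq : forall n, (1 <= n)%N -> (h n + g n <= q n)%N.
Hypothesis hg_io : forall m, exists2 n, (m <= n)%N & (h n + g n < q n)%N.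
Hypothesis qg : forall n, (1 <= n)%N -> (g n = 1 \/ q n <= 3 * g n)%N.
Hypothesis gdim : forall d : R, 0 <= d -> d < 1 ->
  exists C, forall n, qprod R q n `^ d <= C * qprod R g n.

(** The remainder is rescaled to [0, 1) at each step. Where [g n = 1] the digit is 0 and the
    remainder is unchanged, so a prescribed place carries no information on [y]. *)
Fixpoint greedy_rem (y : R) (n : nat) : R :=
  if n is m.+1 then (g m.+1)%:R * greedy_rem y m
                    - (Num.truncn ((g m.+1)%:R * greedy_rem y m))%:R
  else y.

Definition greedy_digit (y : R) (n : nat) : nat :=
  if n is m.+1 then Num.truncn ((g m.+1)%:R * greedy_rem y m) else 0%N.

Let gR_gt0 n : 0 < (g n)%:R :> R.
Proof. by rewrite ltr0n g_gt0. Qed.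

Let gprod_gt0 n : 0 < qprod R g n.
Proof. by elim: n => [|n IH]; rewrite ?qprod0// qprodS mulr_gt0. Qed.

Lemma greedy_remS y n : greedy_rem y n.+1 =
  (g n.+1)%:R * greedy_rem y n - (greedy_digit y n.+1)%:R.
Proof. by []. Qed.

Lemma greedy_rem_itv y n : 0 <= y < 1 -> 0 <= greedy_rem y n < 1.
Proof.
move=> y01; elim: n => [//|n /andP[r0 r1]]; rewrite /=.
have := @truncn_itv _ ((g n.+1)%:R * greedy_rem y n) (mulr_ge0 (ltW (gR_gt0 _)) r0).
by rewrite subr_ge0 ltrBlDl natr1.
Qed.

Lemma greedy_digit_lt y n : 0 <= y < 1 -> (greedy_digit y n < g n)%N.
Proof.
case: n => [|n] y01; first exact: g_gt0.
have /andP[r0 r1] := greedy_rem_itv n y01.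
rewrite -(ltr_nat R) /=.
have /andP[+ _] := @truncn_itv _ ((g n.+1)%:R * greedy_rem y n) (mulr_ge0 (ltW (gR_gt0 _)) r0).
move=> /le_lt_trans; apply.
by rewrite -[ltRHS]mulr1 ltr_pM2l.
Qed.

Lemma greedy_expansion y n : y =
  \sum_(1 <= k < n.+1) (greedy_digit y k)%:R / qprod R g k
  + greedy_rem y n / qprod R g n.
Proof.
elim: n => [|n IH]; first by rewrite big_geq// add0r qprod0 divr1.
rewrite big_nat_recr// {1}IH greedy_remS qprodS.
move: (greedy_digit _ _) (greedy_rem _ _) (\big[_/_]_(_ <= _ < _) _) => D r S /=.
by field; rewrite !gt_eqF.
Qed.

Definition free_digits (y : R) (n : nat) : nat := (h n + greedy_digit y n)%N.

Definition free_point (y : R) : R := cantor_val R q (free_digits y).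

Let fd_lt y n : 0 <= y < 1 -> (1 <= n)%N -> (free_digits y n < q n)%N.
Proof.
move=> y01 n1; apply: leq_trans (hgq n1).
by rewrite ltn_add2l greedy_digit_lt.
Qed.

Let fd_io y m : 0 <= y < 1 -> exists2 n, (m <= n)%N & (free_digits y n).+1 != q n.
Proof.
move=> y01; have [n mn hgn] := hg_io m; exists n => //.
have gd := greedy_digit_lt n y01; rewrite /free_digits.
by apply/eqP; lia.
Qed.

Lemma free_point_digit y n : 0 <= y < 1 -> (1 <= n)%N ->
  cantor_digit q (free_point y) n = (free_digits y n)%:Z.
Proof.
by move=> y01; apply: cantor_val_digit => // [k|m]; [exact: fd_lt|exact: fd_io].
Qed.

(** As long as the digits agree, multiplication by the bases turns [y - y'] into the difference of
    two remainders in [0, 1). *)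
Lemma greedy_dist_agree y y' n : 0 <= y < 1 -> 0 <= y' < 1 ->
  (forall k, (1 <= k <= n)%N -> greedy_digit y k = greedy_digit y' k) ->
  `|y - y'| * qprod R g n <= 1 /\
  `|y - y'| * qprod R g n.+1 <=
    `|(greedy_digit y n.+1)%:R - (greedy_digit y' n.+1)%:R| + 1.
Proof.
move=> y01 y'01 agree.
have E : (y - y') * qprod R g n = greedy_rem y n - greedy_rem y' n.
  rewrite {1}(greedy_expansion y n) {1}(greedy_expansion y' n).
  rewrite (eq_big_nat _ _ (F2 := fun k => (greedy_digit y' k)%:R / qprod R g k)).
    by field; rewrite gt_eqF.
  by move=> k kn; rewrite agree.
have r01 k : `|greedy_rem y k - greedy_rem y' k| <= 1.
  have := greedy_rem_itv k y01; have := greedy_rem_itv k y'01.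
  by move=> /andP[? ?] /andP[? ?]; rewrite ler_norml; lra.
rewrite -(gtr0_norm (gprod_gt0 n)) -(gtr0_norm (gprod_gt0 n.+1)) -!normrM; split.
  by rewrite E.
have -> : (y - y') * qprod R g n.+1 =
    (greedy_digit y n.+1)%:R - (greedy_digit y' n.+1)%:R
    + (greedy_rem y n.+1 - greedy_rem y' n.+1).
  by rewrite qprodS mulrA E !greedy_remS; ring.
by rewrite (le_trans (ler_normD _ _))// lerD2l.
Qed.

(** This is not automatic, since [g] may equal 1 on long stretches. If all digits agreed,
    [qprod R g] would be bounded by the inverse of the distance, and [gdim] at exponent 1/2 would
    bound [qprod R q], which is at least 2^n. *)
Lemma greedy_digit_neq y y' : 0 <= y < 1 -> 0 <= y' < 1 -> y != y' ->
  exists n, greedy_digit y n.+1 != greedy_digit y' n.+1.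
Proof.
move=> y01 y'01 yy'; apply: contrapT => /forallNP H.
have agree k : greedy_digit y k = greedy_digit y' k.
  by case: k => [//|k]; have /negP/negbNE/eqP := H k.
have [C HC] := gdim (d := 2^-1) ltac:(lra) ltac:(lra).
have d0 : 0 < `|y - y'| by rewrite normr_gt0 subr_eq0.
have C0 : 0 < C.
  by have := HC 0%N; rewrite !qprod0 powR1 mulr1 => /(lt_le_trans ltr01).
have G n : qprod R g n <= `|y - y'|^-1.
  have [+ _] := @greedy_dist_agree y y' n y01 y'01 (fun k _ => agree k).
  by rewrite mulrC -ler_pdivlMr// mul1r.
pose M := C * `|y - y'|^-1.
have M0 : 0 < M by rewrite mulr_gt0 ?invr_gt0.
have [n Mn] : exists n : nat, M ^+ 2 < n%:R.
  exists (Num.truncn (M ^+ 2)).+1; exact: truncnS_gt.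
have : qprod R q n <= M ^+ 2.
  have : qprod R q n `^ 2^-1 <= M.
    by apply: (le_trans (HC n)); rewrite ler_pM2l.
  have Q0 := ltW (qprod_gt0 R hq n); rewrite powR12_sqrt// => sM.
  rewrite -[leLHS]sqr_sqrtr//.
  by rewrite ler_sqr ?nnegrE ?sqrtr_ge0 ?(ltW M0).
apply/negP; rewrite -ltNge; apply: (lt_le_trans Mn).
apply: le_trans (qprod_ge2 R hq n).
by rewrite -natrX ler_nat ltnW// ltn_expl.
Qed.

(** Both distances are read off at the first differing digit, of difference [D]: at most 2D over the
    product of the [g], and at least D/2 over the product of the [q]. In the constant 12 = 2 * 3 *
    2, the factors come from [D + 1 <= 2 * D], from [q <= 3 * g] and from bounding the [d]-th power
    of 2. *)
Lemma free_point_holder (d : R) : 0 <= d -> d < 1 -> exists C : R,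
  forall y y' : R, 0 <= y < 1 -> 0 <= y' < 1 ->
    `|y - y'| <= C * `|free_point y - free_point y'| `^ d.
Proof.
move=> d0 d1; have [C HC] := gdim d0 d1.
have C0 : 0 < C.
  by have := HC 0%N; rewrite !qprod0 powR1 mulr1 => /(lt_le_trans ltr01).
exists (12 * C) => y y' y01 y'01.
have [->|yy'] := eqVneq y y'.
  by rewrite subrr normr0 mulr_ge0 ?powR_ge0// mulr_ge0// ltW.
have ex := greedy_digit_neq y01 y'01 yy'.
case: (ex_minnP ex) => n dn minn {ex}.
have agree k : (1 <= k <= n)%N -> greedy_digit y k = greedy_digit y' k.
  case: k => [//|k] /= kn; apply/eqP; apply: contraT => /minn.
  by rewrite leqNgt kn.
have [_ H] := greedy_dist_agree y01 y'01 agree.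
set D := `|(greedy_digit y n.+1)%:R - (greedy_digit y' n.+1)%:R| in H.
have DE : D = `|(greedy_digit y n.+1)%:Z - (greedy_digit y' n.+1)%:Z|%N%:R.
  by rewrite /D -[RHS]/((Posz _)%:~R) abszE intr_norm intrD mulrNz.
have gy := greedy_digit_lt n.+1 y01; have gy' := greedy_digit_lt n.+1 y'01.
have /andP[Dgt0 Dlt] := digit_dist_itv gy gy' dn.
have D1 : 1 <= D by rewrite DE ler1n.
have Dg : D < (g n.+1)%:R by rewrite DE ltr_nat.
(* Two distinct digits exclude the case [g n.+1 = 1]. *)
have g2 : (q n.+1)%:R <= 3 * (g n.+1)%:R :> R.
  have [g1|] := @qg n.+1 isT; first by move: Dg; rewrite g1; lra.
  by rewrite -natrM ler_nat.
have X : D / (2 * qprod R q n.+1) <= `|free_point y - free_point y'|.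
  rewrite /D.
  have -> : (greedy_digit y n.+1)%:R - (greedy_digit y' n.+1)%:R =
      (free_digits y n.+1)%:R - (free_digits y' n.+1)%:R :> R.
    by rewrite /free_digits !natrD; ring.
  apply: cantor_val_dist => //; try by move=> k k1; apply: fd_lt.
  - move=> k k1; apply: (digit_dist_lt _ _ _ (gq k1)); exact: greedy_digit_lt.
  - by move=> k kn; rewrite /free_digits agree.
  - by rewrite /free_digits eqn_add2l.
have Q0 := qprod_gt0 R hq n; have Q1 := qprod_gt0 R hq n.+1.
have Xd : (D / (2 * qprod R q n.+1)) `^ d <= `|free_point y - free_point y'| `^ d.
  by apply: ge0_ler_powR; rewrite ?nnegrE// divr_ge0 ?mulr_ge0 ?ltW//; lra.
suff : D <= 6 * C * qprod R g n.+1 * (D / (2 * qprod R q n.+1)) `^ d.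
  move=> K; rewrite -(ler_pM2r (gprod_gt0 n.+1)); apply: (le_trans H).
  apply: (@le_trans _ _ (2 * D)); first by lra.
  have -> : 12 * C * `|free_point y - free_point y'| `^ d * qprod R g n.+1 =
    2 * (6 * C * qprod R g n.+1 * `|free_point y - free_point y'| `^ d) by ring.
  rewrite ler_pM2l//; apply: (le_trans K); rewrite ler_wpM2l//.
  by rewrite !mulr_ge0 ?ltW.
have DD : D = D `^ d * D `^ (1 - d).
  rewrite -powRD; first by rewrite addrC subrK powRr1//; lra.
  by apply/implyP => _; rewrite gt_eqF//; lra.
have g0 := gR_gt0 n.+1.
have q0 := q_gt0 R hq n.
(* Interpolation: [D] and [q n.+1] are both at most [3 * g n.+1] and the exponents add up to 1. This
   treats the last base separately; [gdim] taken at [n.+1] instead of [n] would lose an unbounded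
   power of [D]. *)
have gg : D `^ (1 - d) * (q n.+1)%:R `^ d <= 3 * (g n.+1)%:R.
  have -> : 3 * (g n.+1)%:R = (3 * (g n.+1)%:R) `^ (1 - d) * (3 * (g n.+1)%:R) `^ d :> R.
    rewrite -powRD; first by rewrite subrK powRr1// ltW// mulr_gt0.
    by apply/implyP => _; rewrite gt_eqF// mulr_gt0.
  by apply: ler_pM; rewrite ?powR_ge0//; apply: ge0_ler_powR; rewrite ?nnegrE//; lra.
have P2 : (2 * qprod R q n.+1) `^ d <= 2 * (C * qprod R g n * (q n.+1)%:R `^ d).
  rewrite powRM// ?(ltW Q1)//; apply: ler_pM; rewrite ?powR_ge0//.
    by apply: ler1_powR; [rewrite ler1n|exact: ltW].
  by rewrite qprodS (powRM _ (ltW Q0) (ltW q0)) ler_wpM2r ?powR_ge0// HC.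
have pw : 0 < (2 * qprod R q n.+1) `^ d by rewrite powR_gt0// mulr_gt0.
have D0 : 0 <= D by lra.
have Q20 : 0 <= 2 * qprod R q n.+1 by rewrite mulr_ge0// ltW.
have Qi0 : 0 <= (2 * qprod R q n.+1)^-1 by rewrite invr_ge0.
rewrite (powRM _ D0 Qi0).
rewrite -(powR_inv1 Q20) -powRrM mulN1r powRN mulrA ler_pdivlMr//.
rewrite {1}DD -[leLHS]mulrA [leRHS]mulrC; apply: ler_wpM2l; first exact: powR_ge0.
apply: (le_trans (ler_wpM2l (powR_ge0 _ _) P2)).
rewrite [leLHS](_ : _ = 2 * C * qprod R g n * (D `^ (1 - d) * (q n.+1)%:R `^ d)); last by ring.
rewrite qprodS [leRHS](_ : _ = 2 * C * qprod R g n * (3 * (g n.+1)%:R)); last by ring.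
by rewrite ler_wpM2l// !mulr_ge0 ?ltW.
Qed.

Lemma hausdorff_dim_free_digits (A : set R) :
  (forall y, 0 <= y < 1 -> A (free_point y)) -> hausdorff_dim A = 1%E.
Proof.
move=> HA; apply/eqP; rewrite eq_le hausdorff_dim_le1/=.
apply: hausdorff_dim_ge1 => d d0 d1; have [C HC] := free_point_holder d0 d1.
by exists free_point, C.
Qed.

End FreeDigits.

(** * Prescribed words in a run *)

Section Words.
Local Open Scope nat_scope.

Lemma size_code (s : seq nat) : size s <= CodeSeq.code s.
Proof.
elim: s => [//|n s IH] /=; apply: (@leq_trans ((CodeSeq.code s).*2.+1)).
  by rewrite ltnS (leq_trans IH)// -addnn leq_addr.
by rewrite leq_pmull// expn_gt0.
Qed.

Lemma size_decode (i : nat) : size (CodeSeq.decode i) <= i.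
Proof. by have := size_code (CodeSeq.decode i); rewrite CodeSeq.decodeK. Qed.

(** The places of a cell from 2^i to 2^(i+1) - 1 belong to the word of code i, whose length is at
    most i. Place 0 also falls in slot 0, harmlessly: the word of code 0 is empty. *)
Definition slot (a r : nat) : nat := trunc_log 2 (r %% a).

Definition slot_word (a r : nat) : seq nat := CodeSeq.decode (slot a r).

Definition slot_pos (a r : nat) : nat := r %% a - 2 ^ slot a r.

(** The successor in [(r %/ a).+1] delays the first marked cell to the end of a period. Were cell 0
    marked, every word would be written there, and the strays counted at the very start of a run
    would not be bounded independently of [a]. *)
Definition placed (l a r : nat) : bool :=
  [&& l <= size (slot_word a r), slot_pos a r < size (slot_word a r)
    & a ^ (size (slot_word a r)).-1 %| (r %/ a).+1].

(* A run of base [a] is cut into cells of length [a]. Inside each cell the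
   places [2^i, 2^i+1, ...] are reserved for the word of code [i], which is
   written in one cell out of [a^(size-1)], hence with density [a^-size]. All
   other digits are the filler [a-1]. *)
Definition run_digit (l a r : nat) : nat :=
  if placed l a r then nth 0 (slot_word a r) (slot_pos a r) else a.-1.

Definition occurs (l a : nat) (B : seq nat) (r : nat) : bool :=
  [seq run_digit l a j | j <- iota r (size B)] == B.

Definition own_place (a : nat) (B : seq nat) (r : nat) : bool :=
  (a ^ (size B).-1 %| (r %/ a).+1) && (r %% a == 2 ^ CodeSeq.code B).

Definition reserved (r : nat) : bool := r - 2 ^ trunc_log 2 r < trunc_log 2 r.

Definition stray_place (a k r : nat) : bool :=
  (a ^ k %| (r %/ a).+1) && reserved (r %% a).

Lemma trunc_log2D i j : j < 2 ^ i -> trunc_log 2 (2 ^ i + j) = i.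
Proof.
by move=> ji; apply: trunc_log_eq => //; rewrite leq_addr/= expnS mul2n -addnn ltn_add2l.
Qed.

Lemma placed_slot l a r : placed l a r ->
  r %% a = 2 ^ slot a r + slot_pos a r /\
  slot_pos a r < slot a r.
Proof.
move=> /and3P[_ pw _]; have sw := size_decode (slot a r).
have pi : slot_pos a r < slot a r by exact: leq_trans pw sw.
split=> //; rewrite /slot_pos subnKC//; apply: trunc_logP => //.
rewrite lt0n; apply/eqP => r0; move: pi.
by rewrite /slot r0 trunc_log0 ltn0.
Qed.

Lemma run_digit_lt l a r : 1 < a -> run_digit l a r < a.
Proof.
move=> a1; rewrite /run_digit; case: ifPn => [pl|_]; last by rewrite prednK// ltnW.
have [rE _] := placed_slot pl; case/and3P: pl => _ pw _.
apply: (@ltn_trans (slot a r)).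
  by have /allP := CodeSeq.gtn_decode (slot a r); apply; exact: mem_nth.
apply: (@leq_trans (r %% a)); last by rewrite ltnW// ltn_pmod// ltnW.
by rewrite rE; apply: leq_trans (leq_addr _ _); exact: ltn_expl.
Qed.

(** Consecutive prescribed places belong to the same word: a word of code i ends before the slot i+1
    begins, and place 0 of a cell always carries the filler. *)
Lemma placedS l a r : 0 < a -> placed l a r -> placed l a r.+1 ->
  [/\ r.+1 %% a = (r %% a).+1, r.+1 %/ a = r %/ a & slot a r.+1 = slot a r].
Proof.
move=> a0 pl plS; have [rE pi] := placed_slot pl; have [rSE _] := placed_slot plS.
have mS := modnS r a; have dS := divnS r a0.
case: (a %| r.+1) in mS dS.
  by move: (expn_gt0 2 (slot a r.+1)); rewrite mS in rSE; lia.
split => //; rewrite {1}/slot mS {1}rE -addnS trunc_log2D//.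
by apply: leq_ltn_trans pi _; exact: ltn_expl.
Qed.

Lemma occurs_placed l a B r : 0 < a -> all (fun b => b < a.-1) B ->
  occurs l a B r -> forall x, x < size B -> placed l a (r + x).
Proof.
move=> a0 aB /eqP oB x xB.
have : run_digit l a (r + x) = nth 0 B x.
  by rewrite -{1}oB (nth_map 0) ?size_iota// nth_iota.
rewrite /run_digit; case: ifP => // _ aE.
by have /(all_nthP 0)/(_ _ xB) := aB; rewrite -aE ltnn.
Qed.

Lemma occurs_same_slot l a B r : 0 < a -> all (fun b => b < a.-1) B ->
  occurs l a B r -> forall x, x < size B ->
  [/\ (r + x) %% a = r %% a + x, (r + x) %/ a = r %/ a & slot a (r + x) = slot a r].
Proof.
move=> a0 aB oB; elim=> [|x IH] xB; first by rewrite !addn0.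
have [e1 e2 e3] := IH (ltnW xB).
have := placedS a0 (occurs_placed a0 aB oB (ltnW xB)).
rewrite -addnS => /(_ (occurs_placed a0 aB oB xB)) [-> -> ->].
by rewrite e1 e2 e3 addnS.
Qed.

(** The letters of [B] differ from the filler, so an occurrence lies inside a single prescribed
    word. Either that word is [B], by injectivity of the code, or it is strictly longer and its
    cells are spaced by a multiple of [a ^ size B]. *)
Lemma occursP l a B r : 0 < a -> 0 < size B -> all (fun b => b < a.-1) B ->
  occurs l a B r ->
  (l <= size B) && own_place a B r || stray_place a (size B) r.
Proof.
move=> a0 B0 aB oB.
have pl := occurs_placed a0 aB oB; have sl := occurs_same_slot a0 aB oB.
have := pl 0 B0; rewrite addn0 => plr; have [rE pi] := placed_slot plr.
have pos x : x < size B -> slot_pos a (r + x) = slot_pos a r + x.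
  by move=> xB; have [e1 _ e3] := sl x xB; rewrite /slot_pos e1 e3 rE; lia.
have fits : slot_pos a r + size B <= size (slot_word a r).
  have xB : (size B).-1 < size B by rewrite prednK.
  have /and3P[_ + _] := pl _ xB; rewrite pos// /slot_word.
  by have [_ _ ->] := sl _ xB; lia.
have digit x : x < size B -> nth 0 B x = nth 0 (slot_word a r) (slot_pos a r + x).
  move=> xB; have /eqP oB' := oB.
  rewrite -{1}oB' (nth_map 0) ?size_iota// nth_iota// /run_digit pl// pos//.
  by rewrite /slot_word; have [_ _ ->] := sl _ xB.
have /and3P[lw pw dv] := plr.
case: (ltngtP (size B) (size (slot_word a r))) => [lt|gt|eq].
- apply/orP; right; rewrite /stray_place /reserved -/(slot a r) -/(slot_pos a r) pi andbT.
  by apply: dvdn_trans dv; rewrite dvdn_exp2l//; lia.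
- by lia.
apply/orP; left; rewrite eq lw/= /own_place eq dv/=.
have p0 : slot_pos a r = 0 by lia.
suff -> : CodeSeq.code B = slot a r by rewrite rE p0 addn0.
rewrite -[slot a r]CodeSeq.decodeK; congr CodeSeq.code.
by apply: (@eq_from_nth _ 0) => // x xB; rewrite digit// p0.
Qed.

Lemma own_occurs l a B r : 0 < a -> 0 < size B -> l <= size B ->
  2 ^ CodeSeq.code B + size B <= a -> own_place a B r -> occurs l a B r.
Proof.
move=> a0 B0 lB aB /andP[dv /eqP rE]; set i := CodeSeq.code B in aB rE.
have Bi : size B <= i by exact: size_code.
have iexp := ltn_expl i (isT : 1 < 2).
have loc x : x < size B -> (r + x) %/ a = r %/ a /\ (r + x) %% a = 2 ^ i + x.
  move=> xB; have xa : 2 ^ i + x < a by lia.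
  have -> : r + x = r %/ a * a + (2 ^ i + x) by rewrite {1}(divn_eq r a) rE addnA.
  by rewrite divnMDl// (divn_small xa) addn0 modnMDl modn_small.
have sl x : x < size B -> slot a (r + x) = i.
  by move=> xB; have [_ e] := loc x xB; rewrite /slot e trunc_log2D//; lia.
apply/eqP/(@eq_from_nth _ 0); first by rewrite size_map size_iota.
move=> x; rewrite size_map size_iota => xB.
rewrite (nth_map 0) ?size_iota// nth_iota//.
have [e1 e2] := loc x xB.
have wE : slot_word a (r + x) = B by rewrite /slot_word sl// CodeSeq.codeK.
have pE : slot_pos a (r + x) = x by rewrite /slot_pos sl// e2; lia.
by rewrite /run_digit /placed wE pE lB xB e1 dv.
Qed.

Lemma sum_cells (f g : nat -> bool) a E : 0 < a ->
  \sum_(0 <= r < E * a) (f (r %/ a) && g (r %% a)) =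
  (\sum_(0 <= e < E) f e) * \sum_(0 <= r < a) g r.
Proof.
move=> a0; elim: E => [|E IH]; first by rewrite mul0n !(big_geq (leqnn 0)).
rewrite mulSn addnC (@big_cat_nat _ _ _ (E * a)) ?leq_addr//= IH big_nat_recr//= mulnDl.
congr (_ + _); rewrite -{1}[X in \sum_(X <= _ < _) _]add0n big_addn addKn big_distrr/=.
apply: eq_big_nat => r /andP[_ ra].
by rewrite addnC divnMDl// (divn_small ra) addn0 modnMDl modn_small// mulnb.
Qed.

Lemma sum_dvdn d E : 0 < d -> \sum_(0 <= e < E) (d %| e.+1) = E %/ d.
Proof.
move=> d0; elim: E => [|E IH]; first by rewrite big_geq// div0n.
by rewrite big_nat_recr//= IH divnS// addnC.
Qed.

Lemma sum_ltn m n : \sum_(0 <= j < m) (j < n) <= n.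
Proof.
suff : \sum_(0 <= j < m) (j < n) <= minn m n by move/leq_trans; apply; exact: geq_minr.
by elim: m => [|m IH]; [rewrite big_geq|rewrite big_nat_recr//=; lia].
Qed.

Lemma sum_eqn m n : \sum_(0 <= j < m) (j == n) = (n < m).
Proof.
elim: m => [|m IH]; first by rewrite big_geq.
by rewrite big_nat_recr//= IH; lia.
Qed.

(** The dyadic range of slot i contains at most i reserved places. *)
Lemma sum_reserved N : \sum_(0 <= r < 2 ^ N) reserved r <= N ^ 2.
Proof.
elim: N => [|N IH]; first by rewrite expn0 big_nat1.
rewrite (@big_cat_nat _ _ _ (2 ^ N)) ?leq_exp2l//=.
rewrite expnS mul2n -addnn -{1}[X in _ + \sum_(X <= _ < _) _]add0n big_addn addnK.
suff : \sum_(0 <= j < 2 ^ N) reserved (j + 2 ^ N) <= N by lia.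
apply: leq_trans (sum_ltn (2 ^ N) N); rewrite big_nat_cond [leqRHS]big_nat_cond.
apply: leq_sum => j; rewrite andbT => /andP[_ jN].
by rewrite /reserved addnC trunc_log2D// addKn.
Qed.

Definition reserved_count (a : nat) : nat := \sum_(0 <= r < a) reserved r.

Lemma sum_mono (f : nat -> nat) m n : m <= n ->
  \sum_(0 <= r < m) f r <= \sum_(0 <= r < n) f r.
Proof. by move=> mn; rewrite [leqRHS](@big_cat_nat _ _ _ m)//= leq_addr. Qed.

Lemma reserved_count_le a : reserved_count a <= (trunc_log 2 a).+1 ^ 2.
Proof.
apply: leq_trans (sum_reserved _); apply: sum_mono.
by apply: ltnW; apply: trunc_log_ltn.
Qed.

Lemma expn3_le N : 10 <= N -> N ^ 3 <= 2 ^ N.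
Proof.
elim: N => [//|N IH]; rewrite leq_eqVlt => /predU1P[<-//|N10].
rewrite [2 ^ _]expnS; have := IH N10; nia.
Qed.

Lemma reserved_count_small c : exists a0, forall a, a0 <= a ->
  c * reserved_count a <= a.
Proof.
(* This makes [N] large enough for both [2 * c <= N] and [N ^ 3 <= 2 ^ N], whence 2cN^2 <= N^3 <=
   2^N <= 2a. *)
exists (2 ^ (10 + 2 * c)) => a aa0; set N := (trunc_log 2 a).+1.
have Nge : 10 + 2 * c < N by rewrite ltnS; apply: trunc_log_max.
have a0 : 0 < a by apply: leq_trans aa0; rewrite expn_gt0.
have Na : 2 ^ N <= 2 * a.
  by rewrite expnS leq_pmul2l//; apply: trunc_logP.
have := reserved_count_le a; rewrite -/N => Z.
have N3 : N ^ 3 <= 2 ^ N by apply: expn3_le; lia.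
have : 2 * (c * N ^ 2) <= N ^ 3.
  by rewrite [N ^ 3]expnS mulnA leq_mul2r; apply/orP; right; lia.
have : c * reserved_count a <= c * N ^ 2 by rewrite leq_mul2l Z orbT.
by lia.
Qed.

(** [m] is rounded up to whole cells. The first term counts the deliberate copies, one per marked
    cell and none when [size B < l]; the second counts the possible strays. *)
Lemma sum_occurs_le l a B m : 1 < a -> 0 < size B -> all (fun b => b < a.-1) B ->
  \sum_(0 <= r < m) occurs l a B r <=
  (l <= size B) * ((m %/ a).+1 %/ a ^ (size B).-1)
  + ((m %/ a).+1 %/ a ^ size B) * reserved_count a.
Proof.
move=> a1 B0 aB; have a0 := ltnW a1.
have ma : m <= (m %/ a).+1 * a by rewrite ltnW// ltn_ceil.
apply: (leq_trans (sum_mono _ ma)).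
apply: (@leq_trans (\sum_(0 <= r < (m %/ a).+1 * a)
  ((l <= size B) * own_place a B r + stray_place a (size B) r))).
  apply: leq_sum => r _; case oB: (occurs l a B r) => //.
  have := occursP a0 B0 aB oB.
  by case: (l <= size B); case: own_place; case: stray_place.
rewrite big_split/= -big_distrr/= /own_place /stray_place.
rewrite (sum_cells (fun e => a ^ (size B).-1 %| e.+1) (fun r => r == 2 ^ CodeSeq.code B))//.
rewrite (sum_cells (fun e => a ^ size B %| e.+1) reserved)//.
rewrite !sum_dvdn ?expn_gt0 ?a0// sum_eqn leq_add2r leq_mul2l.
by apply/orP; right; rewrite -[leqRHS]muln1 leq_mul2l leq_b1 orbT.
Qed.

Lemma sum_occurs_ge l a B m : 1 < a -> 0 < size B -> l <= size B ->
  2 ^ CodeSeq.code B + size B <= a ->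
  m %/ a ^ size B <= \sum_(0 <= r < m) occurs l a B r.
Proof.
move=> a1 B0 lB aB; have a0 := ltnW a1.
apply: leq_trans (sum_mono _ (leq_trunc_div m a)).
apply: (@leq_trans (\sum_(0 <= r < m %/ a * a) own_place a B r)); last first.
  apply: leq_sum => r _; case oB: (own_place a B r) => //.
  by rewrite (own_occurs a0 B0 lB aB oB).
rewrite (sum_cells (fun e => a ^ (size B).-1 %| e.+1) (fun r => r == 2 ^ CodeSeq.code B))//.
rewrite sum_dvdn ?expn_gt0 ?a0// sum_eqn (_ : _ < a = true) ?muln1.
  by rewrite -divnMA -expnS prednK.
by apply: leq_trans aB; rewrite -addn1 leq_add2l.
Qed.

End Words.

(** * Decomposition into passes *)

Lemma size_flatten_mkseq (T : Type) (W : nat -> seq T) N :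
  size (flatten (mkseq W N)) = (\sum_(0 <= p < N) size (W p))%N.
Proof.
elim: N => [|N IH]; first by rewrite big_geq.
by rewrite mkseqS flatten_rcons size_cat IH big_nat_recr.
Qed.

Lemma nth_flatten_mkseq (T : Type) (x0 : T) (W : nat -> seq T) N p r :
  (p < N)%N -> (r < size (W p))%N ->
  nth x0 (flatten (mkseq W N)) (\sum_(0 <= i < p) size (W i) + r)%N
  = nth x0 (W p) r.
Proof.
move=> + rW; elim: N => [//|N IH]; rewrite ltnS leq_eqVlt => pN.
rewrite mkseqS flatten_rcons nth_cat size_flatten_mkseq.
case/predU1P: pN => [pN|pN]; first by rewrite pN ltnNge leq_addr/= addKn -pN.
rewrite IH// (_ : _ < _ = true)%N//.
apply: (@leq_trans (\sum_(0 <= i < p.+1) size (W i))%N).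
  by rewrite big_nat_recr//= ltn_add2l.
by rewrite [leqRHS](@big_cat_nat _ _ _ p.+1)//= leq_addr.
Qed.

Section Passes.
Variables alpha beta s t upsilon q : nat -> nat.
Hypothesis hQ : isQ alpha beta s t upsilon q.

Let word i := nseq (s i) (alpha i) ++ nseq (t i) (beta i).

Let pass_list m := flatten [seq nseq (upsilon i) i | i <- iota 1 m].

Let pass_num m := size (pass_list m).

Let pass_listD N k : pass_list (N + k) =
  pass_list N ++ flatten [seq nseq (upsilon i) i | i <- iota N.+1 k].
Proof. by rewrite /pass_list iotaD map_cat flatten_cat add1n. Qed.

Let pass_listS N : pass_list N.+1 = pass_list N ++ nseq (upsilon N.+1) N.+1.
Proof. by rewrite -[in LHS]addn1 pass_listD /= cats0. Qed.

Let Qprefix_pass m :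
  Qprefix alpha beta s t upsilon m = flatten [seq word i | i <- pass_list m].
Proof.
elim: m => [//|m IH]; rewrite pass_listS map_cat flatten_cat -IH map_nseq.
by rewrite /Qprefix -[m.+1]addn1 iotaD map_cat flatten_cat/= cats0 add1n addn1.
Qed.

Let pass_num_mono m m' : (m <= m')%N -> (pass_num m <= pass_num m')%N.
Proof. by move=> /subnKC <-; rewrite /pass_num pass_listD size_cat leq_addr. Qed.

(** With finitely many passes the prefixes would stabilise, against the infinite length of [q]
    contained in [isQ]. *)
Let pass_num_unbounded p : exists m, (p < pass_num m)%N.
Proof.
apply: contrapT => /forallNP H.
have ub m : (pass_num m <= p)%N by rewrite leqNgt; exact/negP.
have ex : exists n, `[< exists m, pass_num m = n >].
  by exists (pass_num 0); apply/asboolP; exists 0%N.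
have ub' n : `[< exists m, pass_num m = n >] -> (n <= p)%N by move=> /asboolP[m <-].
have [_ /asboolP[m0 <-] mx] := ex_maxnP ex ub'.
have stable m : (m0 <= m)%N -> pass_list m = pass_list m0.
  move=> /subnKC <-; move: (m - m0)%N => k; rewrite pass_listD.
  have : (pass_num (m0 + k) <= pass_num m0)%N.
    by apply: mx; apply/asboolP; exists (m0 + k)%N.
  rewrite /pass_num pass_listD size_cat -{2}[size (pass_list m0)]addn0 leq_add2l leqn0.
  by move=> /eqP/size0nil ->; rewrite cats0.
have [m [+ _]] := hQ (n := (size (Qprefix alpha beta s t upsilon m0)).+1) isT.
rewrite ltnNge => /negP; apply.
rewrite (Qprefix_pass m0) -(stable _ (leq_maxr m m0)) Qprefix_pass.
by rewrite -(subnKC (leq_maxl m m0)) pass_listD map_cat flatten_cat size_cat leq_addr.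
Qed.

Let nu p := nth 0%N (pass_list (xchoose (pass_num_unbounded p))) p.

Let nuE m p : (p < pass_num m)%N -> nu p = nth 0%N (pass_list m) p.
Proof.
rewrite /nu; move: (xchooseP (pass_num_unbounded p)); set m' := xchoose _ => h h'.
rewrite -/(pass_num _) in h *.
have [mm|/ltnW mm] := leqP m m'.
  by rewrite -(subnKC mm) pass_listD nth_cat -/(pass_num m) h'.
by rewrite -(subnKC mm) pass_listD nth_cat -/(pass_num m') h.
Qed.

Let mkseq_nu m : mkseq nu (pass_num m) = pass_list m.
Proof.
apply: (@eq_from_nth _ 0%N); first by rewrite size_mkseq.
by move=> p; rewrite size_mkseq => pm; rewrite nth_mkseq// (nuE pm).
Qed.

Let nu_gt N p : (pass_num N <= p)%N -> (N < nu p)%N.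
Proof.
move=> Np; have [m pm] := pass_num_unbounded p.
have Nm : (N <= m)%N.
  by rewrite leqNgt; apply/negP => /ltnW/pass_num_mono; rewrite leqNgt (leq_ltn_trans Np pm).
rewrite (nuE pm) -(subnKC Nm) pass_listD nth_cat -/(pass_num N) (ltnNge p) Np/=.
set L := flatten _.
have pL : (p - pass_num N < size L)%N.
  rewrite ltn_subLR//; move: pm.
  by rewrite /pass_num -{1}(subnKC Nm) pass_listD size_cat.
have /flatten_mapP[i] := mem_nth 0%N pL.
by rewrite mem_iota => /andP[Ni _] /nseqP[-> _].
Qed.

Let nu_le N p : (p < pass_num N)%N -> (nu p <= N)%N.
Proof.
move=> pN; rewrite (nuE pN); have /flatten_mapP[i] := mem_nth 0%N pN.
by rewrite mem_iota add1n ltnS => /andP[_ iN] /nseqP[-> _].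
Qed.

(** All passes of the blocks of index below [nu p] precede pass [p]; the earlier passes of the same
    block only add to the right side. This turns the sum over blocks in the first limit condition
    into a sum over passes. *)
Let nu_sum (R : numDomainType) (F : nat -> R) p : (forall i, 0 <= F i) ->
  \sum_(1 <= i < nu p) (upsilon i)%:R * F i <= \sum_(0 <= p' < p) F (nu p').
Proof.
move=> F0; have [N nuN] : exists N, nu p = N.+1.
  by exists (nu p).-1; rewrite prednK//; exact: (@nu_gt 0).
have Np : (pass_num N <= p)%N.
  by rewrite leqNgt; apply/negP => /nu_le; rewrite nuN ltnn.
rewrite nuN [leRHS](@big_cat_nat _ _ _ (pass_num N))//= -[leLHS]addr0.
apply: lerD; last by rewrite sumr_ge0.
rewrite -(big_map nu xpredT F) -/(index_iota 0 (pass_num N)).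
have -> : [seq nu i | i <- index_iota 0 (pass_num N)] = pass_list N.
  by rewrite -mkseq_nu /mkseq /index_iota subn0.
rewrite le_eqVlt; apply/orP; left; apply/eqP.
elim: N {nuN Np} => [|N IH]; first by rewrite big_geq// big_nil.
rewrite big_nat_recr//= IH pass_listS big_cat/=; congr (_ + _).
by rewrite big_nseq iter_addr_0 mulr_natl.
Qed.

Definition pass_start (len : nat -> nat) p := (\sum_(0 <= i < p) len i).+1.

Lemma isQ_passes : exists nu : nat -> nat,
  let len p := (s (nu p) + t (nu p))%N in
  [/\ forall p, (0 < nu p)%N,
      forall N, \forall p \near \oo, (N < nu p)%N,
      forall p r, (r < len p)%N -> q (pass_start len p + r) =
        if (r < s (nu p))%N then alpha (nu p) else beta (nu p),
      forall n, exists p, (n < pass_start len p)%N &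
      forall (R : realType) (F : nat -> R) p, (forall i, 0 <= F i) ->
        \sum_(1 <= i < nu p) (upsilon i)%:R * F i <= \sum_(0 <= p' < p) F (nu p')].
Proof.
exists nu => len.
have lenE p : len p = size (word (nu p)) by rewrite /len size_cat !size_nseq.
have QE m : Qprefix alpha beta s t upsilon m = flatten (mkseq (word \o nu) (pass_num m)).
  by rewrite Qprefix_pass -mkseq_nu /mkseq -map_comp.
have sizeQ m : (size (Qprefix alpha beta s t upsilon m)).+1 = pass_start len (pass_num m).
  by rewrite QE size_flatten_mkseq; congr S; apply: eq_big_nat => i _; rewrite lenE.
have start_mono p p' : (p <= p')%N -> (pass_start len p <= pass_start len p')%N.
  by move=> pp; rewrite ltnS [leqRHS](@big_cat_nat _ _ _ p)//= leq_addr.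
split.
- by move=> p; apply: (@nu_gt 0).
- by move=> N; exists (pass_num N) => // p /= /nu_gt.
- move=> p r rp; have [m [le ->]] := hQ (n := (pass_start len p + r)%N) isT.
  have pm : (p < pass_num m)%N.
    rewrite ltnNge; apply/negP => /start_mono; rewrite -sizeQ.
    by move: le; lia.
  rewrite /pass_start addSn/= QE.
  rewrite (eq_big_nat _ _ (F2 := fun i => size ((word \o nu) i))); last first.
    by move=> i _; rewrite lenE.
  rewrite nth_flatten_mkseq//= -?lenE// nth_cat size_nseq !nth_nseq.
  by case: (ltnP r (s (nu p))) => // rs; rewrite ifT// ltn_subLR.
- move=> n; have [m [le _]] := hQ (n := n.+1) isT.
  by exists (pass_num m); rewrite -sizeQ ltnS ltnW.
- by move=> R F p; exact: nu_sum.
Qed.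

End Passes.

(** * Sums over passes *)

Section PassSums.
Variable len : nat -> nat.
Local Notation T := (pass_start len).
Hypothesis T_unbounded : forall n, exists p, (n < T p)%N.

Lemma pass_startS p : T p.+1 = (T p + len p)%N.
Proof. by rewrite /pass_start big_nat_recr//= addSn. Qed.

Lemma pass_start_mono p p' : (p <= p')%N -> (T p <= T p')%N.
Proof. by move=> pp; rewrite ltnS [leqRHS](@big_cat_nat _ _ _ p)//= leq_addr. Qed.

(** This is the first pass starting after [n]; for [n >= 1] its predecessor contains [n], even if
    some passes are empty. *)
Definition pass_of (n : nat) : nat := ex_minn (T_unbounded n).

Definition at_pass (A : Type) (F : nat -> nat -> A) (n : nat) : A :=
  F (pass_of n).-1 (n - T (pass_of n).-1)%N.

Lemma at_passE (A : Type) (F : nat -> nat -> A) p r : (r < len p)%N ->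
  at_pass F (T p + r) = F p r.
Proof.
move=> rp; rewrite /at_pass; suff -> : pass_of (T p + r) = p.+1 by rewrite /= addKn.
rewrite /pass_of; case: ex_minnP => p' lt mn.
apply/eqP; rewrite eqn_leq mn ?pass_startS ?ltn_add2l//= ltnNge.
by apply/negP => /pass_start_mono; rewrite leqNgt (leq_ltn_trans _ lt)// leq_addr.
Qed.

Lemma pass_ex n : (1 <= n)%N -> exists p r, (r < len p)%N /\ n = (T p + r)%N.
Proof.
move=> n1; case: (ex_minnP (T_unbounded n)) => -[|p] lt mn.
  by move: lt; rewrite /pass_start big_geq// ltnS leqNgt n1.
have pn : (T p <= n)%N by rewrite leqNgt; apply/negP => /mn; rewrite ltnn.
exists p, (n - T p)%N; rewrite subnKC// ltn_subLR//.
by rewrite -pass_startS.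
Qed.

Lemma sum_pass_split (R : zmodType) (u : nat -> R) p m :
  \sum_(1 <= j < T p + m) u j =
  \sum_(1 <= j < T p) u j + \sum_(0 <= r < m) u (T p + r)%N.
Proof.
rewrite (@big_cat_nat _ _ _ (T p))//= ?leq_addr//; congr (_ + _).
rewrite -{1}[T p]add0n big_addn addKn.
by apply: eq_big_nat => r _; rewrite addnC.
Qed.

(** An accounting argument: each full pass saves [w p], and a partial pass may spend the accumulated
    savings plus [D]. The passes before the estimates hold are absorbed in [C]. *)
Lemma pass_sum_bounded (R : realType) (u w : nat -> R) (D : R) :
  (\forall p \near \oo, forall m, (m <= len p)%N ->
     \sum_(0 <= r < m) u (T p + r)%N <= D + \sum_(0 <= i < p) w i) ->
  (\forall p \near \oo, \sum_(0 <= r < len p) u (T p + r)%N <= - w p) ->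
  exists C, forall n, \sum_(1 <= j < n.+1) u j <= C.
Proof.
move=> [p1 _ H1] [p2 _ H2]; pose p0 := maxn p1 p2.
have {}H1 p : (p0 <= p)%N -> forall m, (m <= len p)%N ->
    \sum_(0 <= r < m) u (T p + r)%N <= D + \sum_(0 <= i < p) w i.
  by move=> pp; apply: H1 => /=; apply: leq_trans pp; exact: leq_maxl.
have {}H2 p : (p0 <= p)%N -> \sum_(0 <= r < len p) u (T p + r)%N <= - w p.
  by move=> pp; apply: H2 => /=; apply: leq_trans pp; exact: leq_maxr.
pose c := \sum_(1 <= j < T p0) `|u j|.
have full k : \sum_(1 <= j < T (p0 + k)) u j <=
    c - (\sum_(0 <= i < p0 + k) w i - \sum_(0 <= i < p0) w i).
  elim: k => [|k IH].
    by rewrite addn0 subrr subr0 ler_sum// => i _; exact: ler_norm.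
  rewrite addnS pass_startS sum_pass_split [in leRHS]big_nat_recr//=.
  by have := H2 _ (leq_addr k p0); lra.
exists (c + `|D + \sum_(0 <= i < p0) w i|) => n.
have [nT|Tn] := leqP n.+1 (T p0).
  apply: (@le_trans _ _ (\sum_(1 <= j < n.+1) `|u j|)).
    by apply: ler_sum => i _; exact: ler_norm.
  rewrite /c [in leRHS](@big_cat_nat _ _ _ n.+1)//= -addrA lerDl addr_ge0//.
  by rewrite sumr_ge0.
have [p [r [rp nE]]] := pass_ex (ltn0Sn n).
have p0p : (p0 <= p)%N.
  rewrite leqNgt; apply/negP => /pass_start_mono; rewrite pass_startS.
  by move: Tn; rewrite nE; lia.
rewrite nE sum_pass_split -(subnKC p0p).
apply: (le_trans (lerD (full _) (lexx _))); rewrite subnKC//.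
have := H1 _ p0p r (ltnW rp).
have := ler_norm (D + \sum_(0 <= i < p0) w i); lra.
Qed.

End PassSums.

Lemma ratio_cvg1 (R : realType) (N Q X : nat -> R) :
  (forall n, 0 <= X n) ->
  (forall e : R, 0 < e -> exists C : R, forall n, N n <= (1 + e) * X n + C) ->
  (forall e : R, 0 < e -> exists C : R, forall n, - N n <= (-1 + e) * X n + C) ->
  (forall e : R, 0 < e -> exists C : R, forall n, Q n <= (1 + e) * X n + C) ->
  (forall e : R, 0 < e -> exists C : R, forall n, - Q n <= (-1 + e) * X n + C) ->
  Q n @[n --> \oo] --> +oo ->
  N n / Q n @[n --> \oo] --> (1 : R).
Proof.
move=> X0 NU NL QU QL Qoo; apply/cvgrPdist_le => /= e e0.
(* From [d <= 1/2] comes X <= 2(Q + C); then |Q - N| <= 2dX + 2C <= (e/2)(Q + C) + 2C, which is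
   below eQ once Q passes the threshold chosen below. *)
pose d : R := Num.min 2^-1 (e / 8).
have d0 : 0 < d by rewrite lt_min; apply/andP; split; lra.
have d2 : d <= 2^-1 by rewrite ge_min lexx.
have d8 : d <= e / 8 by rewrite ge_min lexx orbT.
have [C1 H1] := NU _ d0; have [C2 H2] := NL _ d0.
have [C3 H3] := QU _ d0; have [C4 H4] := QL _ d0.
pose C : R := `|C1| + `|C2| + `|C3| + `|C4| + 1.
move/cvgryPge : Qoo => /(_ (20 * C / e + C)); apply: filterS => n Qn.
have [a1 a2 a3 a4] : [/\ C1 <= C, C2 <= C, C3 <= C & C4 <= C].
  have := ler_norm C1; have := ler_norm C2; have := ler_norm C3; have := ler_norm C4.
  have := normr_ge0 C1; have := normr_ge0 C2; have := normr_ge0 C3; have := normr_ge0 C4.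
  by rewrite /C => *; split; lra.
have C1' : 1 <= C by rewrite lerDr !addr_ge0.
have eQ : 20 * C + e * C <= e * Q n.
  have -> : 20 * C + e * C = e * (20 * C / e + C) by field; rewrite gt_eqF.
  by rewrite ler_pM2l.
have Cdiv : 0 <= 20 * C / e by rewrite divr_ge0 ?mulr_ge0 ?(ltW e0)//; lra.
have Q0 : 0 < Q n by lra.
have -> : 1 - N n / Q n = (Q n - N n) / Q n by rewrite mulrBl divff ?gt_eqF.
rewrite normrM normfV (gtr0_norm Q0) ler_pdivrMr//.
have h1 := H1 n; have h2 := H2 n; have h3 := H3 n; have h4 := H4 n.
have x0 := X0 n.
have dX : d * X n <= 2^-1 * X n by rewrite ler_wpM2r.
have XQ : X n <= 2 * (Q n + C) by rewrite mulrDl in h4; lra.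
have dXe : d * X n <= e / 8 * (2 * (Q n + C)) by apply: ler_pM => //; exact: ltW.
rewrite !mulrDl in h1 h2 h3 h4.
by rewrite ler_norml; apply/andP; split; lra.
Qed.

(** Up to bounded errors [N] is at most a quarter of [X] and [Q] at least half of it, so N/Q is
    eventually too far below 1. *)
Lemma ratio_not_cvg1 (R : realType) (N Q X : nat -> R) (C : R) :
  (forall n, N n <= 4^-1 * X n + C) -> (forall n, - Q n <= - 2^-1 * X n + C) ->
  Q n @[n --> \oo] --> +oo -> ~ N n / Q n @[n --> \oo] --> (1 : R).
Proof.
move=> NX QX /cvgryPge Qoo /cvgrPdist_lt /(_ 4^-1 ltac:(lra)) NQ.
near \oo => n.
have Qn : 1 + 8 * `|C| <= Q n by near: n; exact: Qoo.
have : `|1 - N n / Q n| < 4^-1 by near: n; exact: NQ.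
have Q0 : 0 < Q n by have := normr_ge0 C; lra.
have -> : 1 - N n / Q n = (Q n - N n) / Q n by rewrite mulrBl divff ?gt_eqF.
rewrite normrM normfV (gtr0_norm Q0) ltr_pdivrMr// ltr_norml => /andP[_].
have := NX n; have := QX n; have := ler_norm C; have := normr_ge0 C.
by lra.
Unshelve. all: by end_near.
Qed.

(** * Mass and word counts along a pass *)

Lemma sum_itv x k m : (\sum_(0 <= r < m) (x <= r < x + k) <= k)%N.
Proof.
suff : (\sum_(0 <= r < m) (x <= r < x + k) <= minn m (x + k) - x)%N by lia.
by elim: m => [|m IH]; [rewrite big_geq|rewrite big_nat_recr//=; lia].
Qed.

Definition edge (M k r : nat) : bool := (r < M)%N && (M < r + k)%N.

Lemma sum_edge (M k m : nat) : (\sum_(0 <= r < m) edge M k r <= k)%N.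
Proof.
apply: leq_trans (sum_itv (M - k) k m); apply: leq_sum => r _.
by rewrite /edge; case: andP => // -[? ?]; case: andP => // -[]; split; lia.
Qed.

Lemma sum_if_ltn (R : pzRingType) (x y : R) s m :
  \sum_(0 <= r < m) (if (r < s)%N then x else y) =
  (minn m s)%:R * x + (m - s)%:R * y.
Proof.
elim: m => [|m IH]; first by rewrite big_geq// min0n sub0n !mul0r addr0.
rewrite big_nat_recr//= IH {IH}; case: (ltnP m s) => ms.
  have [-> -> ->] : [/\ minn m.+1 s = m.+1, m.+1 - s = 0 & m - s = 0]%N.
    by split; lia.
  by rewrite -natr1 mulrDl mul1r !mul0r !addr0.
have [-> ->] : (minn m.+1 s = s /\ m.+1 - s = (m - s).+1)%N.
  by split; lia.
by rewrite -natr1 mulrDl mul1r addrA.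
Qed.

Section PassEstimates.
Variables (R : realType) (l : nat) (a b s t q : nat -> nat).
Let len p := (s p + t p)%N.
Local Notation T := (pass_start len).
Hypothesis T_unbounded : forall n, exists p, (n < T p)%N.
Hypothesis qE : forall p r, (r < len p)%N ->
  q (T p + r) = if (r < s p)%N then a p else b p.
Hypothesis a_gt1 : forall p, (1 < a p)%N.
Hypothesis b_gt1 : forall p, (1 < b p)%N.
Hypothesis a_inf : forall M, \forall p \near \oo, (M <= a p)%N.
Hypothesis b_inf : forall M, \forall p \near \oo, (M <= b p)%N.
Hypothesis t_gt0 : \forall p \near \oo, (0 < t p)%N.
Hypothesis s_large : forall k M, \forall p \near \oo, (M * a p ^ k <= s p)%N.
Hypothesis t_small : forall k M, (l <= k)%N ->
  \forall p \near \oo, (M * (t p * a p ^ k) <= s p * b p ^ k)%N.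

Definition run_density (k : nat) : nat -> R :=
  at_pass T_unbounded (fun p r => if (r < s p)%N then (a p)%:R ^- k else 0).

Let run_mass k p m : R := (minn m (s p))%:R / (a p)%:R ^+ k.

Let a_gt0 p : 0 < (a p)%:R :> R.
Proof. by rewrite ltr0n ltnW. Qed.

Let run_mass_ge0 k p m : 0 <= run_mass k p m.
Proof. by rewrite divr_ge0// exprn_ge0. Qed.

Lemma sum_run_density k p m : (m <= len p)%N ->
  \sum_(0 <= r < m) run_density k (T p + r) = run_mass k p m.
Proof.
move=> ml; rewrite (eq_big_nat _ _
  (F2 := fun r => if (r < s p)%N then (a p)%:R ^- k else 0 : R)).
  by rewrite sum_if_ltn mulr0 addr0.
by move=> r /andP[_ rm]; rewrite /run_density at_passE//; exact: leq_trans ml.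
Qed.

Lemma run_density_ge0 k j : 0 <= run_density k j.
Proof. by rewrite /run_density /at_pass; case: ifP => // _; rewrite invr_ge0 exprn_ge0. Qed.

Lemma nat_large (x : R) : exists N : nat, x <= N%:R.
Proof. by exists (Num.truncn x).+1; exact/ltW/truncnS_gt. Qed.

Lemma run_mass_large k (x : R) : \forall p \near \oo, x <= run_mass k p (s p).
Proof.
have [N xN] := nat_large x; have := s_large k N; apply: filterS => p Np.
apply: (le_trans xN); rewrite /run_mass minnn ler_pdivlMr ?exprn_gt0//.
by rewrite -natrX -natrM ler_nat.
Qed.

(* A bounded error per pass is negligible since the number of terms of the run
   of [a p] exceeds any multiple of [a p ^ k]. *)
Lemma pass_dominated (k : nat) (f : nat -> R) (c D : R) :
  (\forall p \near \oo, forall m, (m <= len p)%N ->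
     \sum_(0 <= r < m) f (T p + r)%N <= c * run_mass k p m + D) ->
  forall e : R, 0 < e -> exists C : R, forall n,
    \sum_(1 <= j < n.+1) f j <= (c + e) * \sum_(1 <= j < n.+1) run_density k j + C.
Proof.
move=> Hf e e0.
suff [C HC] : exists C, forall n,
    \sum_(1 <= j < n.+1) (f j - (c + e) * run_density k j) <= C.
  exists C => n; rewrite -lerBlDl; apply: le_trans (HC n).
  by rewrite mulr_sumr -sumrB.
have S p m : (m <= len p)%N ->
    \sum_(0 <= r < m) (f (T p + r)%N - (c + e) * run_density k (T p + r)) =
    \sum_(0 <= r < m) f (T p + r)%N - (c + e) * run_mass k p m.
  by move=> ml; rewrite sumrB -mulr_sumr sum_run_density.
apply: (pass_sum_bounded T_unbounded (w := fun=> 0) (D := `|D|)).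
  apply: filterS Hf => p Hp m ml; rewrite S// big1_eq addr0.
  have := Hp m ml; have := ler_norm D.
  have : 0 <= e * run_mass k p m by rewrite mulr_ge0// ltW.
  by rewrite mulrDl; lra.
have := run_mass_large k (D / e); have := Hf; apply: filterS2 => p Hp large.
rewrite S// oppr0 subr_le0; apply: (le_trans (Hp _ (leqnn _))).
rewrite mulrDl lerD2l mulrC -ler_pdivrMr//; apply: (le_trans large).
by rewrite /run_mass minnn (minn_idPr (leq_addr _ _)).
Qed.

Definition window_mass (k j : nat) : R := (\prod_(j <= i < j + k) (q i)%:R)^-1.

Let q_ge1 j : (1 <= j)%N -> 1 <= (q j)%:R :> R.
Proof.
move=> /(pass_ex T_unbounded)[p [r [rp ->]]]; rewrite qE// ler1n.
by case: ifP => _; exact: ltnW.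
Qed.

Lemma window_mass_ge0 k j : 0 <= window_mass k j.
Proof. by rewrite invr_ge0 prodr_ge0. Qed.

Lemma window_mass_le1 k j : (1 <= j)%N -> window_mass k j <= 1.
Proof.
move=> j1; have P1 : 1 <= \prod_(j <= i < j + k) (q i)%:R :> R.
  rewrite big_seq_cond; elim/big_ind : _ => //.
    by move=> x y x1 y1; apply: mulr_ege1.
  by move=> i; rewrite andbT mem_index_iota => /andP[ji _]; apply/q_ge1/(leq_trans j1).
by rewrite invf_le1// (lt_le_trans ltr01).
Qed.

Lemma window_mass_const k p r c : (r + k <= len p)%N ->
  (forall i, (r <= i < r + k)%N -> (if (i < s p)%N then a p else b p) = c) ->
  window_mass k (T p + r) = c%:R ^- k.
Proof.
move=> rk H; rewrite /window_mass; congr (_^-1).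
rewrite -{1}[X in index_iota X _]add0n big_addn addKn.
rewrite (eq_big_nat _ _ (F2 := fun=> c%:R)); first by rewrite prodr_const_nat subn0.
move=> i /andP[_ ik]; rewrite addnC -addnA qE; last by lia.
by rewrite H// leq_addr/= ltn_add2l.
Qed.

Let edge_sum M k m : \sum_(0 <= r < m) (edge M k r)%:R <= k%:R :> R.
Proof. by rewrite -natr_sum ler_nat sum_edge. Qed.

Lemma window_mass_ge k p m : (m <= len p)%N ->
  run_mass k p m - k%:R <= \sum_(0 <= r < m) window_mass k (T p + r).
Proof.
move=> ml; rewrite lerBlDr -sum_run_density//.
apply: le_trans (lerD (lexx _) (edge_sum (s p) k m)).
rewrite -big_split/= !big_nat; apply: ler_sum => r /andP[_ rm].
rewrite /run_density at_passE; last exact: leq_trans ml.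
case: ltnP => rs; last by rewrite addr_ge0// window_mass_ge0.
have [rk|rk] := leqP (r + k) (s p).
  rewrite (@window_mass_const _ _ _ (a p)) ?lerDl//; first by rewrite /len; lia.
  by move=> i /andP[_ ik]; rewrite (leq_trans ik rk).
rewrite /edge rs rk/=; apply: (@le_trans _ _ 1); last by rewrite lerDr window_mass_ge0.
by rewrite invf_le1 ?exprn_gt0// exprn_ege1// ler1n ltnW.
Qed.

(** Windows inside one run have constant base. Those straddling the end of the run of [a p] or the
    end of the pass are bounded by 1 each, whence [2 * k]. *)
Lemma window_mass_le k p m : (m <= len p)%N ->
  \sum_(0 <= r < m) window_mass k (T p + r) <=
  run_mass k p m + (m - s p)%:R / (b p)%:R ^+ k + (2 * k)%:R.
Proof.
move=> ml; rewrite /run_mass -sum_if_ltn.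
apply: (@le_trans _ _ (\sum_(0 <= r < m) ((if (r < s p)%N then (a p)%:R ^- k
    else (b p)%:R ^- k) + ((edge (s p) k r)%:R + (edge (len p) k r)%:R)))).
  rewrite !big_nat; apply: ler_sum => r /andP[_ rm].
  have rl : (r < len p)%N := leq_trans rm ml.
  have pos c : 0 <= c%:R ^- k :> R by rewrite invr_ge0 exprn_ge0.
  have [rk|rk] := leqP (r + k) (len p); last first.
    apply: (@le_trans _ _ 1); first exact: window_mass_le1.
    rewrite /edge rl rk/= addrCA addrA lerDr addr_ge0//; case: ifP => _; exact: pos.
  case: ltnP => rs.
    have [rks|rks] := leqP (r + k) (s p).
      rewrite (@window_mass_const _ _ _ (a p)) ?lerDl ?addr_ge0//.
      by move=> i /andP[_ ik]; rewrite (leq_trans ik rks).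
    apply: (@le_trans _ _ 1); first exact: window_mass_le1.
    by rewrite /edge rs rks/= addrCA lerDl addr_ge0.
  rewrite (@window_mass_const _ _ _ (b p)) ?lerDl ?addr_ge0//.
  by move=> i /andP[ri _]; rewrite ltnNge (leq_trans rs ri).
by rewrite !big_split/= mul2n -addnn natrD lerD2l lerD.
Qed.

(** Once a partial pass has entered the run of [b p], the run of [a p] is complete, and [t_small]
    bounds t/b^k by (e/2) s/a^k. The other half of [e] pays for the straddling windows. *)
Lemma Qsum_upper k : (l <= k)%N -> forall e : R, 0 < e -> exists C : R, forall n,
  Qsum R q k n <= (1 + e) * \sum_(1 <= j < n.+1) run_density k j + C.
Proof.
move=> lk e e0; have e2 : 0 < e / 2 by lra.
have -> : 1 + e = (1 + e / 2) + e / 2 by lra.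
apply: (@pass_dominated k (window_mass k) _ (2 * k)%:R) => //.
have [N Ne] := nat_large (e / 2)^-1; have := t_small N lk; apply: filterS => p Hp m ml.
apply: (le_trans (window_mass_le k ml)); rewrite lerD2r mulrDl mul1r lerD2l.
have [ms|ms] := leqP m (s p).
  by rewrite (eqP (ms : (m - s p == 0)%N)) mul0r mulr_ge0// ltW.
have b0 : 0 < (b p)%:R ^+ k :> R by rewrite exprn_gt0// ltr0n ltnW.
have a0 : 0 < (a p)%:R ^+ k :> R by rewrite exprn_gt0.
rewrite /run_mass (minn_idPr (ltnW ms)) ler_pdivrMr//.
apply: (@le_trans _ _ (t p)%:R); first by rewrite ler_nat /len in ml *; lia.
have : (N * (t p * a p ^ k))%:R <= (s p * b p ^ k)%:R :> R by rewrite ler_nat.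
rewrite !natrM !natrX => H.
have ta : (t p)%:R * (a p)%:R ^+ k <= e / 2 * ((s p)%:R * (b p)%:R ^+ k) :> R.
  apply: le_trans (ler_wpM2l (ltW e2) H); rewrite [leRHS]mulrA -[leLHS]mul1r ler_wpM2r//.
  by rewrite mulrC -ler_pdivrMr// mul1r.
rewrite [leRHS](_ : _ = e / 2 * ((s p)%:R * (b p)%:R ^+ k) / (a p)%:R ^+ k); last by ring.
by rewrite ler_pdivlMr.
Qed.

(** The run of [b p] only adds mass, so the bound holds at every order [k]; below [l] it serves to
    refute normality. *)
Lemma Qsum_lower k e : 0 < e -> exists C : R, forall n,
  - Qsum R q k n <= (-1 + e) * \sum_(1 <= j < n.+1) run_density k j + C.
Proof.
move=> e0.
have [|C HC] := @pass_dominated k (fun j => - window_mass k j) (-1) k%:R _ e e0.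
  apply: nearW => p m ml; rewrite sumrN mulN1r -[_ + _]opprK lerN2 opprD opprK.
  exact: window_mass_ge.
by exists C => n; have := HC n; rewrite sumrN.
Qed.

Section Occurrences.
Variable e : nat -> nat.
Hypothesis e_run : forall p r, (r < s p)%N -> e (T p + r) = run_digit l (a p) r.
Hypothesis e_free : forall p r, (s p <= r < len p)%N ->
  (b p - 1 - b p %/ 2 <= e (T p + r))%N.

Definition word_at (B : seq nat) (j : nat) : bool :=
  [seq e i | i <- iota j (size B)] == B.

Variable B : seq nat.
Hypothesis B_gt0 : (0 < size B)%N.

Let large_pass : \forall p \near \oo,
  [/\ all (fun x => x < (a p).-1)%N B,
      all (fun x => x < b p - 1 - b p %/ 2)%N B,
      (2 ^ CodeSeq.code B + size B <= a p)%N & (0 < t p)%N].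
Proof.
have [M BM] : exists M, all (fun x => x <= M)%N B.
  exists (\max_(x <- B) x)%N; apply/allP => x xB; exact: leq_bigmax_seq.
near=> p; split.
- apply: sub_all BM => x xM; apply: (leq_trans (xM : (x < M.+1)%N)).
  have : (M.+2 <= a p)%N by near: p; exact: a_inf.
  by case: (a p).
- apply: sub_all BM => x xM; apply: (leq_trans (xM : (x < M.+1)%N)).
  have : (2 * M.+3 <= b p)%N by near: p; exact: b_inf.
  by lia.
- by near: p; exact: a_inf.
- by near: p; exact: t_gt0.
Unshelve. all: by end_near.
Qed.

Let word_at_digit j x : word_at B j -> (x < size B)%N -> e (j + x) = nth 0%N B x.
Proof.
by move=> /eqP jB xB; rewrite -jB (nth_map 0%N) ?size_iota// nth_iota.
Qed.

Let word_at_run p r : (r + size B <= s p)%N ->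
  word_at B (T p + r) = occurs l (a p) B r.
Proof.
move=> rs; rewrite /word_at /occurs iotaDl -map_comp; congr (_ == _).
apply/eq_in_map => i; rewrite mem_iota => /andP[_ ir] /=.
by apply: e_run; exact: leq_trans rs.
Qed.

Let word_at_edge p r : all (fun x => x < b p - 1 - b p %/ 2)%N B -> (0 < t p)%N ->
  (r < len p)%N -> (s p < r + size B)%N -> ~~ word_at B (T p + r).
Proof.
move=> bB t0 rl sr; apply/negP => wB.
(* [x] points to the first free digit met by the window; the truncated subtraction gives 0 when [r]
   is already in the free run. *)
pose x := (s p - r)%N; have xB : (x < size B)%N by rewrite /x; lia.
have := word_at_digit wB xB; rewrite -addnA.
have := @e_free p (r + x) ltac:(rewrite /x /len in rl *; lia).
have /(all_nthP 0%N)/(_ _ xB) := bB.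
by move=> lt ge eq; move: ge; rewrite eq leqNgt lt.
Qed.

Let sum_word_at_le p m : all (fun x => x < b p - 1 - b p %/ 2)%N B -> (0 < t p)%N ->
  (m <= len p)%N ->
  (\sum_(0 <= r < m) word_at B (T p + r) <=
   \sum_(0 <= r < minn m (s p)) occurs l (a p) B r)%N.
Proof.
move=> bB t0 ml.
rewrite (@big_cat_nat _ _ _ (minn m (s p)))//= ?geq_minl//.
rewrite -[leqRHS]addn0; apply: leq_add.
  rewrite !big_nat; apply: leq_sum => r /andP[_ rm].
  have [rs|sr] := leqP (r + size B) (s p); first by rewrite word_at_run.
  by rewrite (negbTE (word_at_edge _ _ _ sr))//; lia.
rewrite big_nat big1// => r /andP[mr rm].
by rewrite (negbTE (word_at_edge _ _ _ _))//; lia.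
Qed.

Let sum_word_at_ge p m : (m <= len p)%N ->
  (\sum_(0 <= r < minn m (s p)) occurs l (a p) B r <=
   \sum_(0 <= r < m) word_at B (T p + r) + size B)%N.
Proof.
move=> ml; apply: (@leq_trans (\sum_(0 <= r < minn m (s p))
    (word_at B (T p + r) + edge (s p) (size B) r)%N)%N).
  rewrite !big_nat; apply: leq_sum => r /andP[_ rm].
  have [rs|sr] := leqP (r + size B) (s p); first by rewrite word_at_run// leq_addr.
  by rewrite /edge sr (_ : r < s p = true)%N ?addn1; [case: occurs|lia].
rewrite big_split/= leq_add ?sum_edge//.
by apply: sum_mono; exact: geq_minl.
Qed.

Let own_count_le (x m k : nat) : (1 < x)%N -> (0 < k)%N ->
  ((m %/ x).+1 %/ x ^ k.-1 * x ^ k <= m + x ^ k)%N.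
Proof.
move=> x1 k0; have x0 := ltnW x1.
have h1 := leq_trunc_div (m %/ x).+1 (x ^ k.-1).
have h2 := leq_trunc_div m x.
have -> : (x ^ k = x ^ k.-1 * x)%N by rewrite -expnSr prednK.
have h3 : (1 <= x ^ k.-1)%N by rewrite expn_gt0 x0.
rewrite mulnA; apply: (@leq_trans ((m %/ x).+1 * x)); first by rewrite leq_mul2r h1 orbT.
by rewrite mulSn addnC leq_add// leq_pmull.
Qed.

(** There is no additive error: before the first marked cell the quotient vanishes, and afterwards
    rounding up by a cell at most doubles [m]. An additive error would be multiplied by the
    unbounded number of reserved places. *)
Let stray_count_le (x m k : nat) : (1 < x)%N -> (0 < k)%N ->
  ((m %/ x).+1 %/ x ^ k * x ^ k * x <= 2 * m)%N.
Proof.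
move=> x1 k0; have [lt|ge] := ltnP (m %/ x).+1 (x ^ k).
  by rewrite divn_small// !mul0n.
have h1 := leq_trunc_div (m %/ x).+1 (x ^ k).
have h2 := leq_trunc_div m x.
have h3 : (x <= x ^ k)%N by rewrite -{1}[x]expn1 leq_exp2l.
apply: (@leq_trans ((m %/ x).+1 * x)); first by rewrite leq_mul2r h1 orbT.
have h4 : (x <= m %/ x * x)%N.
  by apply: leq_pmull; rewrite -ltnS (leq_trans x1)// (leq_trans h3).
by rewrite mulSn mul2n -addnn leq_add// (leq_trans h4).
Qed.

Lemma word_at_upper (c : R) : c = (l <= size B)%:R -> forall eps : R, 0 < eps ->
  exists C : R, forall n,
  \sum_(1 <= j < n.+1) (word_at B j)%:R <=
    (c + eps) * \sum_(1 <= j < n.+1) run_density (size B) j + C.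
Proof.
move=> cE eps eps0; set k := size B.
have -> : c + eps = (c + eps / 2) + eps / 2 by lra.
apply: (@pass_dominated k (fun j => (word_at B j)%:R) _ 1); last by lra.
(* Reserved places are then at most eps/4 of a cell; with the factor 2 of [stray_count_le], strays
   cost eps/2 of the run mass. *)
have [N Ne] := nat_large (4 / eps).
have [a0 Ha0] := reserved_count_small N.
near=> p => m ml.
have [aB bB _ t0] : [/\ all (fun x => x < (a p).-1)%N B,
      all (fun x => x < b p - 1 - b p %/ 2)%N B,
      (2 ^ CodeSeq.code B + size B <= a p)%N & (0 < t p)%N].
  by near: p; exact: large_pass.
have Z : (N * reserved_count (a p) <= a p)%N by apply: Ha0; near: p; exact: a_inf.
set M := minn m (s p).
have H := leq_trans (sum_word_at_le bB t0 ml) (sum_occurs_le l M (a_gt1 p) B_gt0 aB).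
rewrite -natr_sum; apply: (@le_trans _ _ (_%:R)); first by rewrite ler_nat; exact: H.
rewrite natrD !natrM -cE -/k.
set x := (_ %/ a p ^ k.-1)%N; set y := (_ %/ a p ^ k)%N.
have A0 : 0 < (a p)%:R ^+ k :> R by rewrite exprn_gt0.
have xM : x%:R <= run_mass k p m + 1.
  rewrite /run_mass -/M -(ler_pM2r A0) mulrDl divfK ?gt_eqF// mul1r.
  by rewrite -natrX -natrM -natrD ler_nat; exact: own_count_le.
have yM : y%:R * (reserved_count (a p))%:R <= eps / 2 * run_mass k p m.
  have y1 : y%:R * (a p)%:R ^+ k * (a p)%:R <= 2 * M%:R :> R.
    by rewrite -natrX -!natrM ler_nat; exact: stray_count_le.
  have z1 : (reserved_count (a p))%:R <= eps / 4 * (a p)%:R.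
    have : N%:R * (reserved_count (a p))%:R <= (a p)%:R :> R by rewrite -natrM ler_nat.
    have e4 : 0 < eps / 4 by lra.
    move=> /(ler_wpM2l (ltW e4)); apply: le_trans.
    rewrite mulrA -[leLHS]mul1r ler_wpM2r// -ler_pdivrMl// mulr1.
    by rewrite invf_div.
  apply: (le_trans (ler_wpM2l _ z1)); first by [].
  rewrite /run_mass -/M [leRHS]mulrA ler_pdivlMr//.
  rewrite [leLHS](_ : _ = eps / 4 * (y%:R * (a p)%:R ^+ k * (a p)%:R)); last by ring.
  rewrite [leRHS](_ : _ = eps / 4 * (2 * M%:R)); last by field.
  by rewrite ler_pM2l//; lra.
have cx : c * x%:R <= c * run_mass k p m + 1.
  rewrite cE; case: (l <= size B)%N => /=; first by rewrite !mul1r.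
  by rewrite !mul0r add0r.
by rewrite mulrDl; lra.
Unshelve. all: by end_near.
Qed.

Lemma word_at_lower : (l <= size B)%N -> forall eps : R, 0 < eps ->
  exists C : R, forall n,
  - \sum_(1 <= j < n.+1) (word_at B j)%:R <=
    (-1 + eps) * \sum_(1 <= j < n.+1) run_density (size B) j + C.
Proof.
move=> lB eps eps0; set k := size B.
(* In [k.+1], [k] pays for the windows cut at the end of the run and 1 for the integer part in
   [sum_occurs_ge]. *)
have [|C HC] := @pass_dominated k (fun j => - (word_at B j)%:R) (-1) k.+1%:R _ eps eps0.
  near=> p => m ml.
  have [_ _ cB _] : [/\ all (fun x => x < (a p).-1)%N B,
      all (fun x => x < b p - 1 - b p %/ 2)%N B,
      (2 ^ CodeSeq.code B + size B <= a p)%N & (0 < t p)%N].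
    by near: p; exact: large_pass.
  set M := minn m (s p).
  have H := leq_trans (sum_occurs_ge M (a_gt1 p) B_gt0 lB cB) (sum_word_at_ge ml).
  rewrite sumrN -natr_sum mulN1r -[_ + _]opprK lerN2 opprD opprK lerBlDr.
  have A0 : 0 < (a p)%:R ^+ k :> R by rewrite exprn_gt0.
  apply: (@le_trans _ _ (M %/ a p ^ k).+1%:R); last first.
    by rewrite -natrD ler_nat addnS ltnS.
  rewrite /run_mass -/M ler_pdivrMr// -natrX -natrM ler_nat ltnW//.
  by apply: ltn_ceil; rewrite expn_gt0 ltnW.
by exists C => n; have := HC n; rewrite sumrN.
Unshelve. all: by end_near.
Qed.

End Occurrences.

End PassEstimates.

(** * The dimension of the set *)

Lemma qprod_expR (R : realType) (f : nat -> nat) (n : nat) :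
  (forall j, (1 <= j)%N -> (0 < f j)%N) ->
  qprod R f n = expR (\sum_(1 <= j < n.+1) ln (f j)%:R).
Proof.
move=> f0; elim: n => [|n IH]; first by rewrite qprod0 big_geq// expR0.
by rewrite qprodS IH [in RHS]big_nat_recr//= expRD lnK// posrE ltr0n f0.
Qed.

Lemma ln_nat_ge0 (R : realType) (n : nat) : 0 <= ln (n%:R : R).
Proof. by case: n => [|n]; [rewrite ln0|apply: ln_ge0; rewrite ler1n]. Qed.

Section PassDimension.
Variables (R : realType) (l : nat) (a b s t q : nat -> nat).
Let len p := (s p + t p)%N.
Local Notation T := (pass_start len).
Hypothesis l_gt0 : (0 < l)%N.
Hypothesis T_unbounded : forall n, exists p, (n < T p)%N.
Hypothesis qE : forall p r, (r < len p)%N ->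
  q (T p + r) = if (r < s p)%N then a p else b p.
Hypothesis a_gt1 : forall p, (1 < a p)%N.
Hypothesis b_gt1 : forall p, (1 < b p)%N.
Hypothesis a_inf : forall M, \forall p \near \oo, (M <= a p)%N.
Hypothesis b_inf : forall M, \forall p \near \oo, (M <= b p)%N.
Hypothesis t_gt0 : \forall p \near \oo, (0 < t p)%N.
Hypothesis s_large : forall k M, \forall p \near \oo, (M * a p ^ k <= s p)%N.
Hypothesis t_small : forall k M, (l <= k)%N ->
  \forall p \near \oo, (M * (t p * a p ^ k) <= s p * b p ^ k)%N.
Hypothesis run_cost_past : forall e : R, 0 < e -> \forall p \near \oo,
  (s p)%:R * ln (a p)%:R <= e * \sum_(0 <= i < p) (t i)%:R * ln (b i)%:R.
Hypothesis run_cost_pass : forall e : R, 0 < e -> \forall p \near \oo,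
  (s p)%:R * ln (a p)%:R <= e * ((t p)%:R * ln (b p)%:R).

Let free_width : nat -> nat :=
  at_pass T_unbounded (fun p r => if (r < s p)%N then 1 else b p %/ 2)%N.

(** In the free run the largest admissible digit is [b p - 2]. The maximal digit is thus avoided
    infinitely often, and the admissible digits still tend to infinity. *)
Let free_low : nat -> nat := at_pass T_unbounded
  (fun p r => if (r < s p)%N then run_digit l (a p) r else b p - 1 - b p %/ 2)%N.

Let q_basic : basic_sequence q.
Proof.
by move=> n /(pass_ex T_unbounded)[p [r [rp ->]]]; rewrite qE//; case: ifP.
Qed.

Let width_gt0 n : (0 < free_width n)%N.
Proof. by rewrite /free_width /at_pass; case: ifP => // _; rewrite divn_gt0. Qed.

Let width_half n : (1 <= n)%N -> (2 * free_width n <= (q n).+1)%N.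
Proof.
move=> /(pass_ex T_unbounded)[p [r [rp ->]]]; rewrite /free_width at_passE// qE//.
by have := a_gt1 p; have := b_gt1 p; case: ifP => _; lia.
Qed.

Let low_width n : (1 <= n)%N -> (free_low n + free_width n <= q n)%N.
Proof.
move=> /(pass_ex T_unbounded)[p [r [rp ->]]]; rewrite /free_width /free_low !at_passE// qE//.
case: ifP => _; first by rewrite addn1 run_digit_lt.
by have := b_gt1 p; lia.
Qed.

Let low_width_io m : exists2 n, (m <= n)%N & (free_low n + free_width n < q n)%N.
Proof.
have [p0 _ tp] := t_gt0; have [p1 mp1] := T_unbounded m.
pose p := maxn p0 p1; have {}tp : (0 < t p)%N by apply: tp => /=; exact: leq_maxl.
exists (T p + s p)%N.
  apply: (leq_trans (ltnW mp1)); apply: leq_trans (leq_addr _ _).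
  exact/pass_start_mono/leq_maxr.
have sl : (s p < len p)%N by rewrite /len -addn1 leq_add2l.
rewrite /free_width /free_low !at_passE// qE// ltnn.
by have := b_gt1 p; lia.
Qed.

Let width_third n : (1 <= n)%N -> (free_width n = 1 \/ q n <= 3 * free_width n)%N.
Proof.
move=> /(pass_ex T_unbounded)[p [r [rp ->]]]; rewrite /free_width at_passE// qE//.
by have := b_gt1 p; case: ifP => _; [left|right; lia].
Qed.

Let width_dim (d : R) : 0 <= d -> d < 1 ->
  exists C, forall n, qprod R q n `^ d <= C * qprod R free_width n.
Proof.
move=> d0 d1; pose eta := (1 - d) / 4.
have eta0 : 0 < eta by rewrite /eta; lra.
suff [C HC] : exists C, forall n, \sum_(1 <= j < n.+1)
    (d * ln (q j)%:R - ln (free_width j)%:R) <= C.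
  exists (expR C) => n.
  rewrite (@qprod_expR R q) => [|j /q_basic/ltnW//].
  rewrite (@qprod_expR R free_width) => [|j _]; last exact: width_gt0.
  rewrite -expRD -expRM mulrC ler_expR.
  by have := HC n; rewrite sumrB -mulr_sumr; lra.
have bound p m : (m <= len p)%N -> ln 3 <= 2 * eta * ln (b p)%:R ->
    \sum_(0 <= r < m)
      (d * ln (q (T p + r)%N)%:R - ln (free_width (T p + r)%N)%:R) <=
    (s p)%:R * ln (a p)%:R - (m - s p)%:R * (2 * eta * ln (b p)%:R).
  move=> ml b3.
  apply: (@le_trans _ _ (\sum_(0 <= r < m)
     (if (r < s p)%N then ln (a p)%:R else - (2 * eta * ln (b p)%:R)))); last first.
    rewrite sum_if_ltn mulrN lerD2r ler_wpM2r ?ln_nat_ge0//.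
    by rewrite ler_nat geq_minr.
  rewrite !big_nat; apply: ler_sum => r /andP[_ rm].
  have rl : (r < len p)%N := leq_trans rm ml.
  rewrite qE// /free_width at_passE//; case: ifP => _.
    rewrite ln1 subr0 -[leRHS]mul1r ler_wpM2r ?ln_nat_ge0//; exact: ltW.
  have b0 : 0 < (b p)%:R :> R by rewrite ltr0n ltnW.
  have g0 : 0 < (b p %/ 2)%:R :> R by rewrite ltr0n divn_gt0.
  have : ln (b p)%:R <= ln 3 + ln (b p %/ 2)%:R :> R.
    rewrite -lnM ?posrE// ler_ln ?posrE// ?mulr_gt0// -natrM ler_nat.
    by have := b_gt1 p; lia.
  by move: b3; rewrite /eta; lra.
have b_large : \forall p \near \oo, ln 3 <= 2 * eta * ln (b p)%:R.
  have [N HN] := nat_large (expR (ln 3 / (2 * eta))).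
  apply: filterS (b_inf N) => p Np.
  rewrite mulrC -ler_pdivrMr; last by rewrite mulr_gt0.
  rewrite -ler_expR lnK; last by rewrite posrE ltr0n ltnW.
  by apply: (le_trans HN); rewrite ler_nat.
apply: (pass_sum_bounded T_unbounded
    (w := fun p => eta * ((t p)%:R * ln (b p)%:R)) (D := 0)).
  apply: filterS2 b_large (run_cost_past eta0) => p bp cost m ml.
  apply: (le_trans (bound p m ml bp)).
  rewrite add0r -mulr_sumr; apply: le_trans cost.
  by rewrite gerBl mulr_ge0// mulr_ge0 ?ln_nat_ge0// mulr_ge0// ltW.
apply: filterS2 b_large (run_cost_pass eta0) => p bp cost.
apply: (le_trans (bound p _ (leqnn _) bp)).
by rewrite /len addKn; lra.
Qed.

Lemma block_countE (e : nat -> nat) (x : R) (B : seq nat) (n : nat) :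
  (forall j, (1 <= j)%N -> cantor_digit q x j = (e j)%:Z) ->
  (block_count q B x n)%:R = \sum_(1 <= j < n.+1) (word_at e B j)%:R :> R.
Proof.
move=> xe; rewrite -natr_sum /block_count -sum1_count big_mkcond/=.
rewrite /index_iota subn1 /= !big_seq; congr (_%:R); apply: eq_bigr => j.
rewrite mem_iota => /andP[j1 _].
have -> : [seq cantor_digit q x i | i <- iota j (size B)] =
    [seq b0%:Z | b0 <- [seq e i | i <- iota j (size B)]].
  rewrite -map_comp; apply/eq_in_map => i; rewrite mem_iota => /andP[ji _].
  by rewrite xe//; exact: leq_trans ji.
rewrite (inj_eq (inj_map _)) -/(word_at e B j); first by case: word_at.
by move=> u v [].
Qed.

Lemma hausdorff_dim_passes : fully_divergent R q ->
  hausdorff_dim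
    ((\bigcap_(j in [set j | (l <= j)%N]) @normal_set R q j)
     `\` (\bigcup_(j in [set j | (1 <= j < l)%N]) @normal_set R q j)) = 1%E.
Proof.
move=> hdiv; apply: (hausdorff_dim_free_digits q_basic width_gt0 width_half
  low_width width_third width_dim) => y y01.
pose e := free_digits (R := R) free_width free_low y.
have xe j : (1 <= j)%N -> cantor_digit q (free_point q free_width free_low y) j = (e j)%:Z.
  exact: free_point_digit.
have e_run p r : (r < s p)%N -> e (T p + r)%N = run_digit l (a p) r.
  move=> rs; have rl : (r < len p)%N by rewrite /len ltn_addr.
  (* Width 1 forces the greedy digit 0, so the digit is exactly the prescribed one. *)
  have := @greedy_digit_lt R free_width width_gt0 y (T p + r)%N y01.
  rewrite /e /free_digits [X in (_ < X)%N]at_passE// rs ltnS leqn0 => /eqP ->.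
  by rewrite addn0 /free_low at_passE// rs.
have e_free p r : (s p <= r < len p)%N -> (b p - 1 - b p %/ 2 <= e (T p + r))%N.
  move=> /andP[sr rl]; rewrite /e /free_digits.
  by rewrite {1}/free_low at_passE// ltnNge sr leq_addr.
split.
- move=> k /= lk B; have k0 : (0 < k)%N := leq_trans l_gt0 lk.
  under eq_fun do rewrite (block_countE _ _ xe).
  have B0 : (0 < size B)%N by rewrite size_tuple.
  have lB : (l <= size B)%N by rewrite size_tuple.
  apply: (@ratio_cvg1 _ _ _
    (fun n => \sum_(1 <= j < n.+1) run_density R a T_unbounded k j)).
  + by move=> n; rewrite sumr_ge0// => j _; exact: run_density_ge0.
  + move=> eps eps0.
    have := word_at_upper T_unbounded a_gt1 a_inf b_inf t_gt0 s_large e_run e_free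
      B0 (erefl ((l <= size B)%:R : R)) eps0.
    by rewrite lB size_tuple.
  + move=> eps eps0.
    have := word_at_lower T_unbounded a_gt1 a_inf b_inf t_gt0 s_large e_run
      B0 lB eps0.
    by rewrite size_tuple.
  + by move=> eps; exact: (Qsum_upper T_unbounded qE a_gt1 b_gt1 s_large t_small lk).
  + by move=> eps; exact: (Qsum_lower T_unbounded qE a_gt1 s_large k).
  + exact: hdiv.
(* One block suffices to refute normality of order [k]; any block of length [k] would do. *)
- case=> k /= /andP[k0 kl] /(_ (nseq_tuple k 0%N)).
  under eq_fun do rewrite (block_countE _ _ xe).
  have sB : size (nseq_tuple k 0%N) = k by rewrite size_tuple.
  have B0 : (0 < size (nseq_tuple k 0%N))%N by rewrite sB.
  have lB : (l <= size (nseq_tuple k 0%N))%N = false by rewrite sB leqNgt kl.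
  have half_gt0 : 0 < 2^-1 :> R by lra.
  have quarter_gt0 : 0 < 4^-1 :> R by lra.
  have := word_at_upper T_unbounded a_gt1 a_inf b_inf t_gt0 s_large e_run e_free
    B0 (erefl ((l <= size (nseq_tuple k 0%N))%:R : R)) quarter_gt0.
  rewrite lB sB add0r => -[C1 HC1].
  have [C2 HC2] := Qsum_lower T_unbounded qE a_gt1 s_large k half_gt0.
  apply: (@ratio_not_cvg1 _ _ _
    (fun n => \sum_(1 <= j < n.+1) run_density R a T_unbounded k j)
    (Num.max C1 C2)); last exact: hdiv.
  + by move=> n; apply: (le_trans (HC1 n)); rewrite lerD2l le_max lexx.
  + move=> n; apply: (le_trans (HC2 n)); apply: lerD.
      by rewrite (_ : -1 + 2^-1 = - 2^-1)//; lra.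
    by rewrite le_max lexx orbT.
Qed.

End PassDimension.

Lemma ratio_lim0_le (R : realType) (u v : nat -> R) (e : R) : 0 < e ->
  (forall n, 0 <= v n) -> ratio_lim u v 0%E ->
  \forall n \near \oo, v n != 0 /\ u n <= e * v n.
Proof.
move=> e0 v0 [vn0 /fine_cvg/cvgrPdist_le/(_ e e0) uv].
apply: filterS2 vn0 uv => n vn0 /=; rewrite sub0r normrN => uv; split => //.
have vn : 0 < v n by rewrite lt_neqAle eq_sym vn0 v0.
by rewrite -ler_pdivrMr//; apply: le_trans uv; exact: ler_norm.
Qed.

Theorem theorem3p5 (R : realType) (l : nat) (hl : (1 <= l)%N)
    (alpha beta s t upsilon q : nat -> nat)
    (halpha : basic_sequence alpha) (hbeta : basic_sequence beta)
    (hQ : isQ alpha beta s t upsilon q)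
    (hinf : infinite_in_limit q) (hdiv : fully_divergent R q)
    (h1 : ratio_lim
       (fun n => (s n)%:R * ln (alpha n)%:R : R)
       (fun n => \sum_(1 <= i < n)
                   (upsilon i)%:R * (t i)%:R * ln (beta i)%:R : R) 0%E)
    (h2 : ratio_lim
       (fun n => (s n)%:R * ln (alpha n)%:R : R)
       (fun n => (t n)%:R * ln (beta n)%:R : R) 0%E)
    (h3 : forall k, (l <= k)%N -> ratio_lim
       (fun n => (t n)%:R * (alpha n)%:R ^+ k : R)
       (fun n => (s n)%:R * (beta n)%:R ^+ k : R) 0%E)
    (h4 : forall k, (1 <= k < l)%N -> exists2 c : \bar R, (0 < c)%E &
       ratio_lim
         (fun n => (t n)%:R * (alpha n)%:R ^+ k : R)
         (fun n => (s n)%:R * (beta n)%:R ^+ k : R) c)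
    (h5 : forall k, (1 <= k)%N -> ratio_lim
       (fun n => (alpha n)%:R ^+ k : R) (fun n => (s n)%:R : R) 0%E) :
  hausdorff_dim
    ((\bigcap_(j in [set j | (l <= j)%N]) @normal_set R q j)
     `\` (\bigcup_(j in [set j | (1 <= j < l)%N]) @normal_set R q j)) = 1%E.
Proof.
have [nu [nu_gt0 nu_inf qE T_unbounded nu_sum]] := isQ_passes hQ.
have along (P : nat -> Prop) : (\forall n \near \oo, P n) ->
    \forall p \near \oo, P (nu p).
  move=> [N _ NP]; apply: filterS (nu_inf N) => p Np.
  by apply: NP; exact: ltnW.
pose len p := (s (nu p) + t (nu p))%N.
have a_gt1 p : (1 < alpha (nu p))%N by exact: halpha.
have b_gt1 p : (1 < beta (nu p))%N by exact: hbeta.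
have s_large k M : \forall p \near \oo, (M * alpha (nu p) ^ k <= s (nu p))%N.
  have e0 : 0 < M.+1%:R^-1 :> R by rewrite invr_gt0.
  (* The exponent [k.+1] covers [k = 0], and [M.+1] avoids inverting 0. *)
  have := ratio_lim0_le e0 (fun n => ler0n _ (s n)) (h5 k.+1 isT).
  move=> /along; apply: filterS => p [_].
  rewrite -ler_pdivrMl ?invr_gt0// invrK -natrX -natrM ler_nat; apply: leq_trans.
  by apply: leq_mul => //; rewrite leq_exp2l.
have t_small k M : (l <= k)%N -> \forall p \near \oo,
    (M * (t (nu p) * alpha (nu p) ^ k) <= s (nu p) * beta (nu p) ^ k)%N.
  move=> lk; have e0 : 0 < M.+1%:R^-1 :> R by rewrite invr_gt0.
  have := ratio_lim0_le e0 _ (h3 k lk).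
  move=> /(_ (fun n => mulr_ge0 (ler0n _ _) (exprn_ge0 _ (ler0n _ _)))).
  move=> /along; apply: filterS => p [_].
  rewrite -ler_pdivrMl ?invr_gt0// invrK -!natrX -!natrM ler_nat; apply: leq_trans.
  by rewrite leq_mul2r leqnSn orbT.
have cost_pass (e : R) : 0 < e -> \forall p \near \oo,
    (t (nu p))%:R * ln (beta (nu p))%:R != 0 :> R /\
    (s (nu p))%:R * ln (alpha (nu p))%:R <= e * ((t (nu p))%:R * ln (beta (nu p))%:R).
  move=> e0; apply: (along _ (ratio_lim0_le e0 _ h2)) => n.
  by rewrite mulr_ge0 ?ln_nat_ge0.
(* This is read off the nonvanishing of the denominators in [h2]. *)
have t_gt0 : \forall p \near \oo, (0 < t (nu p))%N.
  apply: filterS (cost_pass 1 ltr01) => p [+ _].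
  by rewrite lt0n; apply: contra => /eqP ->; rewrite mul0r.
have start_inf N : \forall p \near \oo, (N <= pass_start len p)%N.
  have [p0 Np0] := T_unbounded N; exists p0 => // p /= /(pass_start_mono len).
  by apply: leq_trans; exact: ltnW.
have q_inf M : exists N, forall n, (N <= n)%N -> (M <= q n)%N.
  by have [N _ NM] := (cvgnyPge q).1 hinf M; exists N => n Nn; exact: NM.
(* For large [p] both runs are nonempty, so [alpha (nu p)] and [beta (nu p)] are terms of [q], at
   the first place of each run, and inherit its growth. *)
have a_inf M : \forall p \near \oo, (M <= alpha (nu p))%N.
  have [N NM] := q_inf M.
  apply: filterS2 (start_inf N) (s_large 0 1) => p Np; rewrite expn0 muln1 => s0.
  have l0 : (0 < len p)%N by rewrite ltn_addr.
  by have := NM _ (leq_trans Np (leq_addr 0 _)); rewrite qE// s0.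
have b_inf M : \forall p \near \oo, (M <= beta (nu p))%N.
  have [N NM] := q_inf M.
  apply: filterS2 (start_inf N) t_gt0 => p Np t0.
  have sl : (s (nu p) < len p)%N by rewrite /len -addn1 leq_add2l.
  by have := NM _ (leq_trans Np (leq_addr (s (nu p)) _)); rewrite qE// ltnn.
apply: (@hausdorff_dim_passes R l (alpha \o nu) (beta \o nu) (s \o nu) (t \o nu)) => //.
- move=> e e0.
  have S0 n : 0 <= \sum_(1 <= i < n) (upsilon i)%:R * (t i)%:R * ln (beta i)%:R :> R.
    by rewrite sumr_ge0// => i _; rewrite !mulr_ge0 ?ln_nat_ge0.
  apply: filterS (along _ (ratio_lim0_le e0 S0 h1)) => p [_] /le_trans; apply.
  rewrite ler_pM2l//.
  under eq_bigr do rewrite -mulrA.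
  apply: (nu_sum R (fun i => (t i)%:R * ln (beta i)%:R)) => i.
  by rewrite mulr_ge0 ?ln_nat_ge0.
- by move=> e e0; apply: filterS (cost_pass e e0) => p [].
Qed.
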